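(* Let $K=(\psi,\Omega)$ be a K-surface and let $V=(\eta,\Omega)\in \mathrm{R}(K)$. Let $(E_1,E_3)$ be the K-frame on $K$ with dual coframe $(\theta^1,\theta^3)$, let $\omega$ be the angle between $E_1$ and $E_3$, and let $(\bar E_1,\bar E_3)$ be the induced V-frame on $V$. Then $$I_V = c^2\,\theta^1\otimes\theta^1 + 2bc\cos(\omega)\,\theta^1\odot\theta^3 + b^2\,\theta^3\otimes\theta^3,\qquad II_V=\sin(\omega)\left(c\,\theta^1\otimes\theta^1+b\,\theta^3\otimes\theta^3\right),$$ where $b,c,\omega\in C^\infty(\Omega)$ solve the system $$-\mathrm{d}b(E_1)=c\csc(\omega)\,\mathrm{d}\omega(E_3)+b\cot(\omega)\,\mathrm{d}\omega(E_1),\qquad -\mathrm{d}c(E_3)=c\cot(\omega)\,\mathrm{d}\omega(E_3)+b\csc(\omega)\,\mathrm{d}\omega(E_1),$$ $$\operatorname{Hess}\omega\,(E_1,E_3)=\sin(\omega).$$ Furthermore, the curvatures $\kappa_1,\kappa_3$ and torsions $\tau_1,\tau_3$ of the V-net lines tangent to $\bar E_1,\bar E_3$ are $$\kappa_1=c^{-1}\sin(\omega),\quad \tau_1=-c^{-1}\cos(\omega),\quad \kappa_3=b^{-1}\sin(\omega),\quad \tau_3=b^{-1}\cos(\omega).$$ Finally, the mean and Gaussian curvatures of $V$ are $$\mathrm{H}_V=\frac{b+c}{2bc\sin(\omega)},\qquad \mathrm{K}_V=\frac{1}{bc}.$$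
   Context: Everything is smooth. A net is an immersion $\psi:\Omega\to\mathbb{R}^3$ of a simply connected open set $\Omega\subset\mathbb{R}^2$; a surface element is an equivalence class of nets with open rectangular domains, up to diffeomorphic reparametrization. A K-surface is a surface element of constant Gaussian curvature $-1$. Its K-frame $(E_1,E_3)$ consists of unit (with respect to $I_K$) vector fields on $\Omega$ along the two asymptotic directions (they commute); $(\theta^1,\theta^3)$ is the dual coframe, $\omega\in(0,\pi)$ the angle between $E_1$ and $E_3$, and $I_K=\theta^1\otimes\theta^1+2\cos\omega\,\theta^1\odot\theta^3+\theta^3\otimes\theta^3$, $II_K=2\sin\omega\,\theta^1\odot\theta^3$, where $\theta^1\odot\theta^3=\frac12(\theta^1\otimes\theta^3+\theta^3\otimes\theta^1)$. $\operatorname{Hess}\omega(E_1,E_3)$ is $E_1(E_3(\omega))$. A map $\eta:\Omega\to\mathbb{R}^3$ is a rotation field of $\psi$ if there is $\xi:\Omega\to\mathbb{R}^3$ with $\mathrm{d}\xi=\eta\times\mathrm{d}\psi$. $\mathrm{R}(K)$ is the set of rotation fields of $K$ that are immersions with nondegenerate second fundamental form; its members are called V-surfaces. The tangent planes of $\eta$ and $\psi$ at corresponding points are parallel, and the unit normal of $\psi$ is also used as unit normal of $\eta$. The rotation operator is $A=\mathrm{d}\psi^{-1}\circ\mathrm{d}\eta$; it has the form $A=b\,E_1\otimes\theta^3+c\,E_3\otimes\theta^1$ (i.e. $AE_1=cE_3$, $AE_3=bE_1$), which defines the nowhere vanishing functions $b,c$. The induced V-frame is $\bar E_1=c^{-1}E_1$,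 $\bar E_3=b^{-1}E_3$; these are unit vector fields for $I_V$ whose integral curves are geodesics of $V$ and conjugate to each other (the V-net lines). Sign conventions: since the V-net lines are geodesics, their (signed) curvatures are the normal curvatures $\kappa_i=II_V(\bar E_i,\bar E_i)$, $i=1,3$, and their torsions are the geodesic torsions $\tau_1=II_V(\bar E_1,\bar E_2)$, $\tau_3=II_V(\bar E_3,\bar E_4)$, where $\bar E_2=\csc(\omega)\bar E_3-\cot(\omega)\bar E_1$ and $\bar E_4=\cot(\omega)\bar E_3-\csc(\omega)\bar E_1$ are the unit vectors obtained by rotating $\bar E_1$ and $\bar E_3$ by $\pi/2$ in the direction of the rotation by $\omega$ taking $\bar E_1$ to $\bar E_3$. *)

(* Defs.v *)
From HB Require Import structures.
From mathcomp Require Import all_boot all_order all_algebra.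
From mathcomp Require Import all_classical all_reals all_analysis.

Set Implicit Arguments.
Unset Strict Implicit.
Unset Printing Implicit Defensive.

Import Order.TTheory GRing.Theory Num.Theory.
Import numFieldNormedType.Exports.

Local Open Scope classical_set_scope.
Local Open Scope ring_scope.

(* Only the values of [f] on the open set [D] matter: for [k >= 1], [Ck k D f]
   says that [f] is differentiable at every point of [D] and that each of its
   directional derivatives is of class C^(k-1) on [D]. *)
Fixpoint Ck (R : realType) (V : normedModType R) (k : nat)
    (D : set 'rV[R]_2) (f : 'rV[R]_2 -> V) : Prop :=
  match k with
  | 0 => forall p, D p -> {for p, continuous f}
  | k'.+1 => (forall p, D p -> differentiable f p) /\
             (forall v : 'rV[R]_2, Ck k' D (fun p => 'D_v f p))
  end.

Definition smooth (R : realType) (V : normedModType R)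
    (D : set 'rV[R]_2) (f : 'rV[R]_2 -> V) : Prop :=
  forall k, Ck k D f.

Definition dot (R : realType) (n : nat) (u v : 'rV[R]_n) : R :=
  \sum_(i < n) u 0 i * v 0 i.

(* Indices are taken modulo 3. *)
Definition cross (R : realType) (u v : 'rV[R]_3) : 'rV[R]_3 :=
  \row_k (u 0 (k + 1) * v 0 (k + 2%:R) - u 0 (k + 2%:R) * v 0 (k + 1)).

Definition csc (R : realType) (x : R) : R := (sin x)^-1.
Definition cot (R : realType) (x : R) : R := cos x / sin x.

(* The endpoints may be infinite. *)
Definition open_rectangle (R : realType) (a b c d : \bar R) : set 'rV[R]_2 :=
  [set p | [/\ (a < (p 0 0)%:E)%E, ((p 0 0)%:E < b)%E,
               (c < (p 0 1)%:E)%E & ((p 0 1)%:E < d)%E]].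

Definition diffeomorphic (R : realType) (Q D : set 'rV[R]_2) : Prop :=
  exists phi phi' : 'rV[R]_2 -> 'rV[R]_2,
    [/\ smooth Q phi, smooth D phi',
        (forall q, Q q -> D (phi q) /\ phi' (phi q) = q) &
        (forall p, D p -> Q (phi' p) /\ phi (phi' p) = p)].

Definition immersion (R : realType) (D : set 'rV[R]_2)
    (f : 'rV[R]_2 -> 'rV[R]_3) : Prop :=
  smooth D f /\ forall p, D p -> injective ('d f p).

(* A net representing a surface element: its domain is an open rectangle or a
   diffeomorphic image of one, hence simply connected. *)
Definition surface_element (R : realType) (D : set 'rV[R]_2)
    (psi : 'rV[R]_2 -> 'rV[R]_3) : Prop :=
  [/\ open D,
      exists a b c d : \bar R, diffeomorphic (open_rectangle a b c d) D &
      immersion D psi].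

Definition unit_normal (R : realType) (D : set 'rV[R]_2)
    (psi N : 'rV[R]_2 -> 'rV[R]_3) : Prop :=
  smooth D N /\ forall p, D p ->
    dot (N p) (N p) = 1 /\ forall v, dot (N p) ('d psi p v) = 0.

Definition fundI (R : realType) (f : 'rV[R]_2 -> 'rV[R]_3)
    (p u v : 'rV[R]_2) : R :=
  dot ('d f p u) ('d f p v).

(* Second fundamental form of [f] with respect to the unit normal [N]. *)
Definition fundII (R : realType) (f N : 'rV[R]_2 -> 'rV[R]_3)
    (p u v : 'rV[R]_2) : R :=
  - dot ('d N p u) ('d f p v).

Definition gram (R : realType) (B : 'rV[R]_2 -> 'rV[R]_2 -> R) : 'M[R]_2 :=
  \matrix_(i, j) B (delta_mx 0 i) (delta_mx 0 j).

(* The matrix, acting on row vectors, of the shape operator S determined by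
   I (S u, v) = II (u, v). *)
Definition shape_mx (R : realType) (f N : 'rV[R]_2 -> 'rV[R]_3)
    (p : 'rV[R]_2) : 'M[R]_2 :=
  gram (fundII f N p) *m invmx (gram (fundI f p)).

Definition gauss_curvature (R : realType) (f N : 'rV[R]_2 -> 'rV[R]_3)
    (p : 'rV[R]_2) : R :=
  \det (shape_mx f N p).

Definition mean_curvature (R : realType) (f N : 'rV[R]_2 -> 'rV[R]_3)
    (p : 'rV[R]_2) : R :=
  \tr (shape_mx f N p) / 2.

Definition K_surface (R : realType) (D : set 'rV[R]_2)
    (psi N : 'rV[R]_2 -> 'rV[R]_3) : Prop :=
  [/\ surface_element D psi, unit_normal D psi N &
      forall p, D p -> gauss_curvature psi N p = -1].

(* Unit asymptotic vector fields are determined only up to sign. The last clause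
   fixes the relative sign by the convention
   II (E1, E3) = sin omega > 0, where 0 < omega < pi; it also makes
   E1 and E3 linearly independent. *)
Definition K_frame (R : realType) (D : set 'rV[R]_2)
    (psi N : 'rV[R]_2 -> 'rV[R]_3) (E1 E3 : 'rV[R]_2 -> 'rV[R]_2) : Prop :=
  [/\ smooth D E1, smooth D E3 & forall p, D p ->
      [/\ fundI psi p (E1 p) (E1 p) = 1,
          fundI psi p (E3 p) (E3 p) = 1,
          fundII psi N p (E1 p) (E1 p) = 0,
          fundII psi N p (E3 p) (E3 p) = 0 &
          0 < fundII psi N p (E1 p) (E3 p)]].

Definition frame_angle (R : realType) (D : set 'rV[R]_2)
    (psi : 'rV[R]_2 -> 'rV[R]_3) (E1 E3 : 'rV[R]_2 -> 'rV[R]_2)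
    (omega : 'rV[R]_2 -> R) : Prop :=
  forall p, D p ->
    0 < omega p < pi /\ cos (omega p) = fundI psi p (E1 p) (E3 p).

Definition dual_coframe (R : realType) (D : set 'rV[R]_2)
    (E1 E3 : 'rV[R]_2 -> 'rV[R]_2)
    (th1 th3 : 'rV[R]_2 -> {linear 'rV[R]_2 -> R}) : Prop :=
  forall p, D p ->
    [/\ th1 p (E1 p) = 1, th1 p (E3 p) = 0,
        th3 p (E1 p) = 0 & th3 p (E3 p) = 1].

Definition tensor (R : realType) (al be : 'rV[R]_2 -> R)
    (u v : 'rV[R]_2) : R :=
  al u * be v.

Definition sym_tensor (R : realType) (al be : 'rV[R]_2 -> R)
    (u v : 'rV[R]_2) : R :=
  (tensor al be u v + tensor be al u v) / 2.

Definition rotation_field (R : realType) (D : set 'rV[R]_2)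
    (psi eta : 'rV[R]_2 -> 'rV[R]_3) : Prop :=
  smooth D eta /\
  exists xi : 'rV[R]_2 -> 'rV[R]_3, smooth D xi /\
    forall p, D p -> forall v, 'd xi p v = cross (eta p) ('d psi p v).

(* The set R(K). The unit normal [N] of [psi] is also the one used for [eta]. *)
Definition V_surface (R : realType) (D : set 'rV[R]_2)
    (psi N eta : 'rV[R]_2 -> 'rV[R]_3) : Prop :=
  [/\ rotation_field D psi eta, immersion D eta &
      forall p, D p -> forall u,
        (forall v, fundII eta N p u v = 0) -> u = 0].

(* A = dpsi^-1 \o deta: ['J psi p] is the matrix of ['d psi p] acting on row
   vectors, and [pinvmx] inverts it on its row space, the tangent plane of
   [psi], which contains the range of ['d eta p]. *)
Definition rotation_op (R : realType) (psi eta : 'rV[R]_2 -> 'rV[R]_3)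
    (p v : 'rV[R]_2) : 'rV[R]_2 :=
  'd eta p v *m pinvmx ('J psi p).

(* The rotation operator has the form
   A = b E1 (x) th3 + c E3 (x) th1; its coefficients are read off from
   A E3 = b E1 and A E1 = c E3. *)
Definition coef_b (R : realType) (psi eta : 'rV[R]_2 -> 'rV[R]_3)
    (E3 : 'rV[R]_2 -> 'rV[R]_2) (th1 : 'rV[R]_2 -> {linear 'rV[R]_2 -> R})
    (p : 'rV[R]_2) : R :=
  th1 p (rotation_op psi eta p (E3 p)).

Definition coef_c (R : realType) (psi eta : 'rV[R]_2 -> 'rV[R]_3)
    (E1 : 'rV[R]_2 -> 'rV[R]_2) (th3 : 'rV[R]_2 -> {linear 'rV[R]_2 -> R})
    (p : 'rV[R]_2) : R :=
  th3 p (rotation_op psi eta p (E1 p)).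

Definition vframe (R : realType) (f : 'rV[R]_2 -> R)
    (E : 'rV[R]_2 -> 'rV[R]_2) (p : 'rV[R]_2) : 'rV[R]_2 :=
  (f p)^-1 *: E p.

(* The unit vectors obtained by rotating [F1] and [F3] by pi / 2, in the
   direction of the rotation by omega taking [F1] to [F3]. *)
Definition vframe2 (R : realType) (omega : 'rV[R]_2 -> R)
    (F1 F3 : 'rV[R]_2 -> 'rV[R]_2) (p : 'rV[R]_2) : 'rV[R]_2 :=
  csc (omega p) *: F3 p - cot (omega p) *: F1 p.

Definition vframe4 (R : realType) (omega : 'rV[R]_2 -> R)
    (F1 F3 : 'rV[R]_2 -> 'rV[R]_2) (p : 'rV[R]_2) : 'rV[R]_2 :=
  cot (omega p) *: F3 p - csc (omega p) *: F1 p.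

(* The V-net lines are geodesics, so their signed curvatures and torsions are
   the normal curvature and the geodesic torsion in the direction of the unit
   tangent [X]; [JX] is [X] rotated by pi / 2. *)
Definition net_curvature (R : realType) (f N : 'rV[R]_2 -> 'rV[R]_3)
    (X : 'rV[R]_2 -> 'rV[R]_2) (p : 'rV[R]_2) : R :=
  fundII f N p (X p) (X p).

Definition net_torsion (R : realType) (f N : 'rV[R]_2 -> 'rV[R]_3)
    (X JX : 'rV[R]_2 -> 'rV[R]_2) (p : 'rV[R]_2) : R :=
  fundII f N p (X p) (JX p).

(* Hess f (X, Y) := X (Y (f)). *)
Definition hess (R : realType) (f : 'rV[R]_2 -> R)
    (X Y : 'rV[R]_2 -> 'rV[R]_2) (p : 'rV[R]_2) : R :=
  'd (fun q => 'd f q (Y q) : R) p (X p).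

(* Main.v *)
Require Import Defs.
From HB Require Import structures.
From mathcomp Require Import all_boot all_order all_algebra.
From mathcomp Require Import all_classical all_reals all_analysis.
From mathcomp Require Import ring lra.

Set Implicit Arguments.
Unset Strict Implicit.
Unset Printing Implicit Defensive.

Import Order.TTheory GRing.Theory Num.Theory.
Import numFieldNormedType.Exports.

Local Open Scope classical_set_scope.
Local Open Scope ring_scope.

(* Write p_i, n_i for the derivatives of psi and N along E_i.  K = -1 forces
   II (E1, E3) = sin omega, so n1 = cot p1 - csc p3 and n3 = cot p3 - csc p1.
   Differentiating all inner products of p_i, n_j and comparing with the bracket
   relations for psi and N gives a linear system in the coefficients of
   [E1, E3] whose only solution is 0.  Once E1 and E3 commute, the tangential
   parts of the second derivatives of psi are determined by d omega, and
   differentiating <E3 p3, p1> = - sin omega * E3 omega along E1 is the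
   sine-Gordon equation.
   For a rotation field, d xi = eta x d psi is closed, so A is traceless; the
   symmetry of the second fundamental form of eta then kills the diagonal of A,
   that is E1 eta = c p3 and E3 eta = b p1.  The first-order system for b, c is
   E3 (c p3) = E1 (b p1), and everything else is linear algebra in the frame. *)

(** * Functions of class C^k *)

(** [E1] and [E3] are given as vector fields, not as coordinate fields, so their commutation has to
    come out of the structure equations. The bracket relation for [psi] alone cannot decide it: the
    unknown inner products of the mixed derivatives with the frame absorb any bracket. The same
    bracket applied to [N] brings in the Codazzi equations. Curvature -1 makes the coefficient of II
    a function of the metric angle, so both sets of equations contain the same derivatives of omega,
    and these can be eliminated. Neither the angle nor the coefficients b, c come with any
    regularity. The angle is recovered from its cosine, and b, c from quotients of inner products
    that agree on [D] with the coefficients of the rotation operator. *)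

Section differential.
Context {R : realType} {U V W X : normedModType R}.

(** Both functions have the same first-order expansion at [p], and a differential is unique.
    Functions here are total while identities hold on [D] only, so passing from an identity to its
    derivative rests on this. *)
Lemma differentiable_near_eq (f g : U -> V) p :
  (\near p, f p = g p) -> differentiable f p ->
  differentiable g p /\ 'd g p = 'd f p :> (U -> V).
Proof.
move=> fg df.
have key : g \o shift p = cst (g p) + 'd f p +o_ 0 id.
  apply/eqaddoP => _/posnumP[e].
  have /eqaddoP/(_ e%:num (gt0 e)) := diff_locally df.
  move: fg; rewrite (near_shift 0) subr0 => fg.
  have fg0 : f p = g p by have := nbhs_singleton fg; rewrite /= add0r.
  apply: filterS2 fg => h /= eqh.
  by rewrite !fctE /= eqh -fg0.
have cd := diff_continuous df.
have dg := diff_unique cd key.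
split=> //; apply/diff_locallyP; rewrite dg; split => //.
Qed.

(** Leibniz rule in one stroke for the inner product and for scalar multiplication. *)
Lemma diff_bilin_comp (B : {bilinear V -> W -> X}) (f : U -> V) (g : U -> W) p :
  continuous (fun q => B q.1 q.2) ->
  differentiable f p -> differentiable g p ->
  differentiable (fun q => B (f q) (g q)) p /\
  forall v, 'd (fun q => B (f q) (g q)) p v =
            B ('d f p v) (g p) + B (f p) ('d g p v).
Proof.
move=> cB df dg.
have dp := differentiable_pair df dg.
have dB := differentiable_bilin (f p, g p) cB.
have E : (fun q => B (f q) (g q)) = (fun q => B q.1 q.2) \o (fun q => (f q, g q)).
  by [].
split; first by rewrite E; apply: differentiable_comp.
by move=> v; rewrite E diff_comp// diff_bilin// diff_pair//= addrC.
Qed.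

End differential.

Section Ck.
Context {R : realType} {D : set 'rV[R]_2} (oD : open D).

Lemma Ck_ext {V : normedModType R} k (f g : 'rV[R]_2 -> V) :
  (forall p, D p -> f p = g p) -> Ck k D f -> Ck k D g.
Proof.
have nearD (u v : 'rV[R]_2 -> V) p :
    (forall q, D q -> u q = v q) -> D p -> \near p, u p = v p.
  by move=> uv Dp; near=> q; apply: uv; near: q; exact: open_nbhs_nbhs.
elim: k f g => [|k IH] f g fg /=.
  move=> cf p Dp; rewrite /prop_for /continuous_at -fg//.
  apply: cvg_trans (cf p Dp).
  apply: (@near_eq_cvg _ _ _ (nbhs_filter p)).
  by apply: nearD Dp => q Dq; rewrite fg.
move=> [df Hf].
have nfg p : D p -> \near p, f p = g p by exact: nearD.
split=> [p Dp|v].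
  by have [] := differentiable_near_eq (nfg p Dp) (df p Dp).
by apply: IH (Hf v) => p Dp; apply: near_eq_derive; apply: nfg.
Unshelve. all: by end_near. Qed.

Lemma CkW {V : normedModType R} k (f : 'rV[R]_2 -> V) : Ck k.+1 D f -> Ck k D f.
Proof.
elim: k f => [|k IH] f [df Hf] /=.
  by move=> p Dp; exact/differentiable_continuous/df.
by split=> // v; apply: IH (Hf v).
Qed.

Lemma Ck_cst {V : normedModType R} k (a : V) : Ck k D (fun=> a).
Proof.
elim: k a => [|k IH] a /=; first by move=> p _; exact: (@cst_continuous _ _ a p).
split=> [p _|v]; first exact: differentiable_cst.
by apply: Ck_ext (IH 0) => p _; rewrite derive_cst.
Qed.

Lemma CkD {V : normedModType R} k (f g : 'rV[R]_2 -> V) :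
  Ck k D f -> Ck k D g -> Ck k D (fun p => f p + g p).
Proof.
elim: k f g => [|k IH] f g /=.
  by move=> cf cg p Dp; apply: continuousD; [exact: cf|exact: cg].
move=> [df Hf] [dg Hg]; split=> [p Dp|v].
  by apply: differentiableD; [apply: df|apply: dg].
apply: Ck_ext (IH _ _ (Hf v) (Hg v)) => p Dp.
by rewrite deriveD//; apply: diff_derivable; [apply: df|apply: dg].
Qed.

(** A derivative of [B (f p) (g p)] is a sum of two terms of the same shape, each with one factor
    differentiated; [CkW] lowers the order of the other factor so that the induction hypothesis
    applies. *)
Lemma Ck_bilin {U V W : normedModType R} (B : {bilinear U -> V -> W}) k
    (f : 'rV[R]_2 -> U) (g : 'rV[R]_2 -> V) :
  continuous (fun q => B q.1 q.2) ->
  Ck k D f -> Ck k D g -> Ck k D (fun p => B (f p) (g p)).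
Proof.
move=> cB; elim: k f g => [|k IH] f g.
  move=> cf cg p Dp.
  apply: (@continuous_comp _ _ _ (fun p => (f p, g p)) (fun q => B q.1 q.2)).
    exact: (@cvg_pair _ _ _ _ _ _ (nbhs_filter p)
              (nbhs_filter (f p)) (nbhs_filter (g p)) f g (cf p Dp) (cg p Dp)).
  exact: cB.
move=> Ff Fg; have [df Hf] := Ff; have [dg Hg] := Fg.
split=> [p Dp|v].
  by have [] := diff_bilin_comp cB (df p Dp) (dg p Dp).
have := CkD (IH _ _ (Hf v) (CkW Fg)) (IH _ _ (CkW Ff) (Hg v)).
apply: Ck_ext => p Dp; have [dB dBE] := diff_bilin_comp cB (df p Dp) (dg p Dp).
by rewrite !deriveE ?dBE//; [apply: dg|apply: df].
Qed.

Lemma Ck_lin {V W : normedModType R} (L : {linear V -> W}) k (f : 'rV[R]_2 -> V) :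
  continuous L -> Ck k D f -> Ck k D (fun p => L (f p)).
Proof.
move=> cL; elim: k f => [|k IH] f /=.
  move=> cf p Dp; apply: (@continuous_comp _ _ _ f L); first exact: cf.
  exact: cL.
have dL v : differentiable L v by exact: linear_differentiable.
move=> [df Hf]; split=> [p Dp|v].
  by apply: differentiable_comp; [exact: df|exact: dL].
apply: Ck_ext (IH _ (Hf v)) => p Dp.
have dLf : differentiable (L \o f) p by apply: differentiable_comp; [exact: df|exact: dL].
rewrite (deriveE v dLf) deriveE ?(diff_comp (df p Dp) (dL _)) ?diff_lin//.
exact: df.
Qed.

End Ck.

(** * Inner product and scalar multiplication as bilinear maps *)

Section dot.
Context {R : realType} {n : nat}.
Implicit Types u v w : 'rV[R]_n.

Lemma dotC u v : dot u v = dot v u.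
Proof. by apply: eq_bigr => i _; rewrite mulrC. Qed.

Lemma dotDl u v w : dot (u + v) w = dot u w + dot v w.
Proof. by rewrite -big_split; apply: eq_bigr => i _; rewrite mxE mulrDl. Qed.

Lemma dotZl a u w : dot (a *: u) w = a * dot u w.
Proof. by rewrite mulr_sumr; apply: eq_bigr => i _; rewrite mxE mulrA. Qed.

Lemma dotDr u v w : dot w (u + v) = dot w u + dot w v.
Proof. by rewrite !(dotC w) dotDl. Qed.

Lemma dotZr a u w : dot w (a *: u) = a * dot w u.
Proof. by rewrite !(dotC w) dotZl. Qed.

Lemma dotNl u w : dot (- u) w = - dot u w.
Proof. by rewrite -scaleN1r dotZl mulN1r. Qed.

Lemma dot_is_bilinear : bilinear_for
  (GRing.Scale.Law.clone _ _ *:%R _) (GRing.Scale.Law.clone _ _ *:%R _)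
  (@dot R n).
Proof.
split=> [u'|u] a x y /=; first by rewrite dotDl dotZl.
by rewrite dotDr dotZr.
Qed.
HB.instance Definition _ := bilinear_isBilinear.Build R 'rV[R]_n 'rV[R]_n R
  _ _ (@dot R n) dot_is_bilinear.

Lemma dot_continuous : continuous (fun q : 'rV[R]_n * 'rV[R]_n => dot q.1 q.2).
Proof.
move=> q; apply: (@continuous_big _ _ +%R) => [|i _].
  exact: add_continuous.
move=> {}q; apply: (@continuousM R ('rV[R]_n * 'rV[R]_n)%type
    (fun q => q.1 0 i) (fun q => q.2 0 i) q).
  apply: (@continuous_comp _ _ _ fst (fun u : 'rV[R]_n => u 0 i)).
    exact: cvg_fst.
  exact: coord_continuous.
apply: (@continuous_comp _ _ _ snd (fun u : 'rV[R]_n => u 0 i)).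
  exact: cvg_snd.
exact: coord_continuous.
Qed.

End dot.

Section scale.
Context {R : realType} {V : normedModType R}.

Lemma scale_is_bilinear : bilinear_for
  (GRing.Scale.Law.clone _ _ *:%R _) (GRing.Scale.Law.clone _ _ *:%R _)
  (@GRing.scale R V).
Proof.
split=> [u'|u] a x y /=; first by rewrite scalerDl scalerA.
by rewrite scalerDr !scalerA mulrC.
Qed.
HB.instance Definition _ := bilinear_isBilinear.Build R R V V
  _ _ (@GRing.scale R V) scale_is_bilinear.
End scale.

(** * Algebraic operations on C^k functions *)

Section CkR.
Context {R : realType} {D : set 'rV[R]_2} (oD : open D).
Implicit Types f g : 'rV[R]_2 -> R.

Lemma Ck_dot n k (f g : 'rV[R]_2 -> 'rV[R]_n) :
  Ck k D f -> Ck k D g -> Ck k D (fun p => dot (f p) (g p)).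
Proof. exact: (Ck_bilin oD dot_continuous). Qed.

Lemma CkZ {V : normedModType R} k f (g : 'rV[R]_2 -> V) :
  Ck k D f -> Ck k D g -> Ck k D (fun p => f p *: g p).
Proof.
apply: (@Ck_bilin _ _ oD R V V (@GRing.scale R V)).
exact: scale_continuous.
Qed.

Lemma CkM k f g : Ck k D f -> Ck k D g -> Ck k D (fun p => f p * g p).
Proof. exact: CkZ. Qed.

Lemma CkN {V : normedModType R} k (f : 'rV[R]_2 -> V) :
  Ck k D f -> Ck k D (fun p => - f p).
Proof.
move=> Hf; apply: (Ck_ext oD _ (CkZ (Ck_cst oD k (-1 : R)) Hf)) => p _.
by rewrite scaleN1r.
Qed.

Lemma CkB {V : normedModType R} k (f g : 'rV[R]_2 -> V) :
  Ck k D f -> Ck k D g -> Ck k D (fun p => f p - g p).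
Proof. by move=> Hf Hg; apply: CkD => //; apply: CkN. Qed.

Lemma CkV k f :
  (forall p, D p -> f p != 0) -> Ck k D f -> Ck k D (fun p => (f p)^-1).
Proof.
move=> f0; elim: k => [|k IH] Ff.
  by move=> p Dp; apply: continuousV; [exact: f0|exact: Ff].
have [df Hf] := Ff; split=> [p Dp|v].
  by apply: differentiableV; [exact: df|exact: f0].
have IV := IH (CkW Ff).
apply: Ck_ext (CkN (CkM (CkM IV IV) (Hf v))) => // p Dp.
by rewrite deriveV ?f0//; [rewrite -mulNr -exprVn expr2|exact/diff_derivable/df].
Qed.

Lemma Ck_coord m n k (f : 'rV[R]_2 -> 'M[R]_(m, n)) i j :
  Ck k D f -> Ck k D (fun p => f p i j).
Proof.
have @L : {linear 'M[R]_(m, n) -> R}.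
  by exists (fun N : 'M[R]_(_, _) => N i j); do 2![eexists]; do ?[constructor];
     rewrite ?mxE// => ? *; rewrite ?mxE//; move=> ?; rewrite !mxE.
by apply: (Ck_lin oD (L := L)); apply: coord_continuous.
Qed.

End CkR.

(** * Smooth functions and recovery of an angle from its cosine *)

Section smooth.
Context {R : realType} {D : set 'rV[R]_2} (oD : open D).

Lemma smooth_differentiable {V : normedModType R} (f : 'rV[R]_2 -> V) p :
  smooth D f -> D p -> differentiable f p.
Proof. by move=> Sf Dp; have [df _] := Sf 1%N; exact: df. Qed.

Lemma smooth_derive {V : normedModType R} (f : 'rV[R]_2 -> V) v :
  smooth D f -> smooth D ('D_v f).
Proof. by move=> Sf k; have [_] := Sf k.+1; exact. Qed.

Lemma diff_coord {V : normedModType R} (f : 'rV[R]_2 -> V) p u :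
  differentiable f p ->
  'd f p u = u 0 0 *: 'D_(delta_mx 0 0) f p + u 0 1 *: 'D_(delta_mx 0 1) f p.
Proof.
move=> df; rewrite {1}(row_sum_delta u) !big_ord_recl big_ord0 addr0.
rewrite (_ : lift ord0 ord0 = 1); last exact: val_inj.
by rewrite linearD !linearZ /= !deriveE.
Qed.

Lemma smooth_diff {V : normedModType R} (f : 'rV[R]_2 -> V)
    (E : 'rV[R]_2 -> 'rV[R]_2) :
  smooth D f -> smooth D E -> smooth D (fun p => 'd f p (E p)).
Proof.
move=> Sf SE k; apply: (Ck_ext oD
  (f := fun p => E p 0 0 *: 'D_(delta_mx 0 0) f p +
                 E p 0 1 *: 'D_(delta_mx 0 1) f p)) => [p Dp|].
  by rewrite diff_coord//; exact: smooth_differentiable.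
by apply: CkD => //; apply: CkZ => //;
  try exact: Ck_coord; exact: smooth_derive.
Qed.

Lemma derive_comp_real (g : R -> R) (f : 'rV[R]_2 -> R) p v dg :
  differentiable f p -> is_derive (f p) 1 g dg ->
  differentiable (g \o f) p /\ 'D_v (g \o f) p = dg * 'D_v f p.
Proof.
move=> df [dgf dgE].
have dgf' : differentiable g (f p) by exact/derivable1_diffP.
have dc : differentiable (g \o f) p by exact: differentiable_comp.
split=> //; rewrite deriveE// diff_comp//= diff1E// derive1E dgE deriveE//.
by rewrite mulrC.
Qed.

(** The two statements form one induction because sine and cosine occur in each other's
    derivative. *)
Lemma Ck_sin_cos k (f : 'rV[R]_2 -> R) :
  Ck k D f -> Ck k D (fun p => sin (f p)) /\ Ck k D (fun p => cos (f p)).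
Proof.
elim: k f => [|k IH] f Ff.
  split=> p Dp; apply: (@continuous_comp _ _ _ f); try exact: Ff.
    exact: continuous_sin.
  exact: continuous_cos.
have [df Hf] := Ff; have [Fs Fc] := IH _ (CkW Ff).
split; (split=> [p Dp|v]).
- by have [] := derive_comp_real 0 (df p Dp) (is_derive_sin (f p)).
- apply: (Ck_ext oD _ (CkM oD Fc (Hf v))) => p Dp.
  by have [_ <-] := derive_comp_real v (df p Dp) (is_derive_sin (f p)).
- by have [] := derive_comp_real 0 (df p Dp) (is_derive_cos (f p)).
- apply: (Ck_ext oD _ (CkM oD (CkN oD Fs) (Hf v))) => p Dp.
  by have [_ <-] := derive_comp_real v (df p Dp) (is_derive_cos (f p)).
Qed.

(** On the open interval [f] equals [acos (cos (f q))], which gives differentiability. From then on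
    the derivative of [f] is that of [cos f] divided by [- sin f]; since [sin f] is as regular as
    [f] and never 0, the order climbs by one at each round. *)
Lemma smooth_angle (f : 'rV[R]_2 -> R) :
  (forall p, D p -> 0 < f p < pi) -> smooth D (fun p => cos (f p)) ->
  smooth D f.
Proof.
move=> f0pi Sc.
have df p : D p -> differentiable f p.
  move=> Dp; have /andP[f0 fpi] := f0pi p Dp.
  have cb : -1 < cos (f p) < 1.
    have := sin_gt0_pi (f0pi p Dp); have := cos2Dsin2 (f p).
    by rewrite -ltr_norml => cs s0; rewrite -(@expr_lt1 _ 2)// real_normK ?num_real//; nra.
  have [dac _] := derive_comp_real 0 (smooth_differentiable Sc Dp)
    (is_derive1_acos cb).
  have nE : \near p, acos (cos (f p)) = f p.
    near=> q; have /f0pi/andP[g0 gpi] : D q by near: q; exact: open_nbhs_nbhs.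
    by rewrite cosK// in_itv/= !ltW.
  by have [] := differentiable_near_eq nE dac.
elim=> [|k IH]; first by move=> p Dp; exact/differentiable_continuous/df.
split=> // v; have [Fs _] := Ck_sin_cos IH.
have s0 p : D p -> sin (f p) != 0.
  by move=> Dp; rewrite gt_eqF// sin_gt0_pi// f0pi.
have [_ Hc] := Sc k.+1.
apply: (Ck_ext oD _ (CkM oD (CkN oD (CkV oD s0 Fs)) (Hc v))) => p Dp.
have [_] := derive_comp_real v (df p Dp) (is_derive_cos (f p)).
rewrite /comp => ->; rewrite mulNr mulrA mulrN mulVf ?s0//; ring.
Unshelve. all: by end_near. Qed.

End smooth.

(** * Symmetry of second derivatives *)

Section schwarz.
Context {R : realType} {D : set 'rV[R]_2} (oD : open D).

Lemma is_derive_line (f : 'rV[R]_2 -> R) u q s :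
  differentiable f (s *: u + q) ->
  is_derive s 1 (fun t : R => f (t *: u + q)) ('D_u f (s *: u + q)).
Proof.
move=> df; pose l (t : R) := t *: u + q.
have dl : is_diff s l (fun t : R => t *: u) by apply: is_diff_eq; rewrite addr0.
have dfl : differentiable (f \o l) s by exact: differentiable_comp.
apply: DeriveDef; first exact: diff_derivable.
by rewrite (@deriveE _ _ _ _ _ (1 : R) dfl) diff_comp//= diff_val scale1r deriveE.
Qed.

Lemma MVT0 (g dg : R -> R) (h : R) : 0 < h ->
  (forall s : R, 0 <= s <= h -> is_derive s 1 g (dg s)) ->
  exists2 s, 0 <= s <= h & g h - g 0 = dg s * h.
Proof.
move=> h0 dgE.
have [s||s] := @MVT _ g dg 0 h h0.
- by rewrite in_itv/= => /andP[? ?]; apply: dgE; rewrite !ltW.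
- apply: derivable_within_continuous => s; rewrite in_itv/= => sh.
  by have [] := dgE s sh.
rewrite in_itv/= subr0 => /andP[? ?] E; exists s => //.
by rewrite !ltW.
Qed.

(** The mean value theorem, along [u] and then along [v], turns the mixed difference into [h ^+ 2]
    times ['D_v ('D_u f)] at some point of a small parallelogram; continuity of that derivative at
    [p] does the rest. *)
Lemma second_difference (f : 'rV[R]_2 -> R) p u v (e : R) :
  Ck 2 D f -> D p -> 0 < e ->
  exists2 d : R, 0 < d & forall h, 0 < h < d ->
    `|f (h *: u + (h *: v + p)) - f (h *: u + p) - f (h *: v + p) + f p
      - h ^+ 2 * 'D_v ('D_u f) p| <= h ^+ 2 * e.
Proof.
move=> [df Hf] Dp e0; have [ddf cddf] := Hf u.
have /cvgrPdist_le/(_ e e0) ce := cddf v p Dp.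
have : nbhs p (D `&` [set q | `|'D_v ('D_u f) p - 'D_v ('D_u f) q| <= e]).
  by apply: filterI => //; exact: open_nbhs_nbhs.
move=> /nbhs_ballP[r /= r0 rD].
have uv0 : 0 < `|u| + `|v| + 1 by rewrite ltr_wpDl// addr_ge0.
(* The radius is chosen so that the parallelogram spanned by [h *: u] and [h *: v] stays in the
   ball; the [+ 1] covers the case [u = v = 0]. *)
exists (r / (`|u| + `|v| + 1)); first by rewrite divr_gt0.
move=> h /andP[h0 hd].
have near_p s t : 0 <= s <= h -> 0 <= t <= h -> ball p r (s *: u + (t *: v + p)).
  move=> /andP[s0 sh] /andP[t0 th]; rewrite -ball_normE /=.
  rewrite distrC addrA addrK.
  apply: (le_lt_trans (ler_normD _ _)); rewrite !normrZ !ger0_norm//.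
  have : h * (`|u| + `|v| + 1) < r by rewrite -ltr_pdivlMr.
  have := ler_wpM2r (normr_ge0 u) sh; have := ler_wpM2r (normr_ge0 v) th.
  nra.
have Dst s t : 0 <= s <= h -> 0 <= t <= h -> D (s *: u + (t *: v + p)).
  by move=> sh th; have [] := rD _ (near_p s t sh th).
have h00 : 0 <= (0 : R) <= h by rewrite lexx ltW.
have h0h : 0 <= h <= h by rewrite lexx ltW.
have dphi s : 0 <= s <= h ->
    is_derive s 1 (fun s => f (s *: u + (h *: v + p)) - f (s *: u + p))
      ('D_u f (s *: u + (h *: v + p)) - 'D_u f (s *: u + p)).
  move=> sh; apply: is_deriveB; apply: is_derive_line; apply: df.
    exact: Dst.
  by have := Dst s 0 sh h00; rewrite scale0r add0r.
have [s sh phiE] := MVT0 h0 dphi.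
have dpsi t : 0 <= t <= h ->
    is_derive t 1 (fun t => 'D_u f (t *: v + (s *: u + p)))
      ('D_v ('D_u f) (t *: v + (s *: u + p))).
  by move=> th; apply: is_derive_line; apply: ddf; rewrite addrCA; exact: Dst.
have [t th psiE] := MVT0 h0 dpsi.
have [_ /= Est] := rD _ (near_p s t sh th).
move: phiE psiE; rewrite !scale0r !add0r (addrCA (h *: v)).
rewrite (addrCA (t *: v)) => phiE psiE.
rewrite {}psiE in phiE; move: phiE Est; rewrite distrC.
move: ('D_v ('D_u f) _) ('D_v ('D_u f) _) => B Bst phiE Est.
have -> : f (h *: u + (h *: v + p)) - f (h *: u + p) - f (h *: v + p) + f p
    - h ^+ 2 * B = h ^+ 2 * (Bst - B).
  transitivity (Bst * h * h - h ^+ 2 * B); last by ring.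
  by move: phiE; move: (f _) (f _) (f _) (f _) => a b c d <-; ring.
by rewrite normrM ger0_norm ?sqr_ge0// ler_wpM2l ?sqr_ge0.
Qed.

(** The mixed difference is symmetric in [u] and [v], so for one small [h] both mixed derivatives
    lie within [e / 2] of the same difference quotient. *)
Lemma schwarz_real (f : 'rV[R]_2 -> R) p u v :
  Ck 2 D f -> D p -> 'D_u ('D_v f) p = 'D_v ('D_u f) p.
Proof.
move=> Ff Dp; apply/eqP; rewrite -subr_eq0 -normr_le0; apply/ler_addgt0Pr => e e0.
rewrite add0r.
have e2 : 0 < e / 2 by rewrite divr_gt0.
have [d1 d10 H1] := second_difference u v Ff Dp e2.
have [d2 d20 H2] := second_difference v u Ff Dp e2.
pose h := Num.min d1 d2 / 2.
have m0 : 0 < Num.min d1 d2 by rewrite lt_min d10.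
have h0 : 0 < h by rewrite divr_gt0.
have : h < Num.min d1 d2 by rewrite /h ltr_pdivrMr// mulr2n mulrDr mulr1 ltrDl.
rewrite lt_min => /andP[hd1 hd2].
have := H1 h; rewrite h0 hd1 => /(_ isT) {}H1.
have := H2 h; rewrite h0 hd2 => /(_ isT) {}H2.
rewrite -(ler_pM2l (exprn_gt0 2 h0)) -[h ^+ 2 in leLHS]gtr0_norm ?exprn_gt0//.
rewrite -normrM; move: H1 H2; rewrite (addrCA (h *: v)).
move: ('D_u _ p) ('D_v _ p) (f _) (f _) (f _) (f _) (h ^+ 2) => A B a b c d k.
by rewrite !ler_norml; lra.
Qed.

Lemma derive_coord m n (f : 'rV[R]_2 -> 'M[R]_(m, n)) p v i j :
  differentiable f p -> 'D_v f p i j = 'D_v (fun q => f q i j) p.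
Proof. by move=> df; rewrite derive_mx ?mxE//; exact: diff_derivable. Qed.

Lemma schwarz m n (f : 'rV[R]_2 -> 'M[R]_(m, n)) p u v :
  smooth D f -> D p -> 'D_u ('D_v f) p = 'D_v ('D_u f) p.
Proof.
move=> Sf Dp; apply/matrixP => i j.
have E x y : 'D_x ('D_y f) p i j = 'D_x ('D_y (fun q => f q i j)) p.
  rewrite derive_coord; last exact/(smooth_differentiable _ Dp)/smooth_derive.
  apply: near_eq_derive; near=> q; rewrite derive_coord//.
  by apply: smooth_differentiable => //; near: q; exact: open_nbhs_nbhs.
have Fij := Ck_coord oD i j (Sf 2%N).
have H := schwarz_real u v Fij Dp.
exact: (etrans (E u v) (etrans H (esym (E v u)))).
Unshelve. all: by end_near. Qed.

End schwarz.

(** * Derivatives along vector fields and the bracket *)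

Section vector_fields.
Context {R : realType} {D : set 'rV[R]_2} (oD : open D).
Implicit Types X Y : 'rV[R]_2 -> 'rV[R]_2.

Lemma diff_dot n (f g : 'rV[R]_2 -> 'rV[R]_n) p v :
  differentiable f p -> differentiable g p ->
  'd (fun q => dot (f q) (g q)) p v = dot ('d f p v) (g p) + dot (f p) ('d g p v).
Proof. by move=> df dg; have [_ ->] := diff_bilin_comp dot_continuous df dg. Qed.

Lemma differentiable_scale {V : normedModType R} (f : 'rV[R]_2 -> R)
    (g : 'rV[R]_2 -> V) p :
  differentiable f p -> differentiable g p ->
  differentiable (fun q => f q *: g q) p /\
  forall v, 'd (fun q => f q *: g q) p v = 'd f p v *: g p + f p *: 'd g p v.
Proof.
move=> df dg.
by apply: (@diff_bilin_comp _ _ _ _ _ (@GRing.scale R V) f g p _ df dg);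
  exact: scale_continuous.
Qed.

Lemma diff_eq_on {V : normedModType R} (f g : 'rV[R]_2 -> V) p v :
  smooth D f -> D p -> (forall q, D q -> f q = g q) -> 'd f p v = 'd g p v.
Proof.
move=> Sf Dp fg.
have nfg : \near p, f p = g p.
  by near=> q; apply: fg; near: q; exact: open_nbhs_nbhs.
by have [_ ->] := differentiable_near_eq nfg (smooth_differentiable Sf Dp).
Unshelve. all: by end_near. Qed.

(** Expanding [Y] in the constant fields [delta_mx 0 i] reduces this to the product rule. In the
    last term the vector [Y p] is frozen, so [schwarz] makes that term symmetric in [u] and
    [Y p]. *)
Lemma diff_vfield n (f : 'rV[R]_2 -> 'rV[R]_n) Y p u :
  smooth D f -> smooth D Y -> D p ->
  'd (fun q => 'd f q (Y q)) p u = 'd f p ('d Y p u) + 'D_u ('D_(Y p) f) p.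
Proof.
move=> Sf SY Dp.
have dY := smooth_differentiable SY Dp.
have df := smooth_differentiable Sf Dp.
have dDf w : differentiable ('D_w f) p.
  exact: smooth_differentiable (smooth_derive w Sf) Dp.
have dYi i : differentiable (fun q => Y q 0 i) p.
  by apply: (smooth_differentiable _ Dp) => k; exact: Ck_coord.
have dYiE i w : 'd (fun q => Y q 0 i) p w = ('d Y p w) 0 i.
  by rewrite -(deriveE _ (dYi i)) -(deriveE _ dY) (derive_coord w 0 i dY).
pose Zf i q := Y q 0 i *: 'D_(delta_mx 0 i) f q.
have Z q : D q -> 'd f q (Y q) = (Zf 0 + Zf 1) q.
  by move=> Dq; exact/diff_coord/(smooth_differentiable Sf Dq).
have dZ i : differentiable (Zf i) p.
  by have [] := differentiable_scale (dYi i) (dDf (delta_mx 0 i)).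
have H i : 'D_(delta_mx 0 i) ('D_u f) p = 'd ('D_(delta_mx 0 i) f) p u.
  exact: (etrans (schwarz oD _ u Sf Dp) (deriveE u (dDf _))).
have ZiE i : 'd (Zf i) p u = 'd Y p u 0 i *: 'D_(delta_mx 0 i) f p +
                         Y p 0 i *: 'D_(delta_mx 0 i) ('D_u f) p.
  rewrite H -dYiE.
  by have [_] := differentiable_scale (dYi i) (dDf (delta_mx 0 i)); exact.
have ZE : 'd (Zf 0 + Zf 1) p u = 'd (Zf 0) p u + 'd (Zf 1) p u.
  exact: (congr1 (@^~ u) (diffD (dZ 0) (dZ 1))).
have HY := etrans (schwarz oD u (Y p) Sf Dp)
  (etrans (deriveE _ (dDf u)) (diff_coord (Y p) (dDf u))).
have E1 := etrans (diff_eq_on u (smooth_diff oD Sf SY) Dp Z)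
  (etrans ZE (congr2 +%R (ZiE 0) (ZiE 1))).
apply: (etrans E1).
by rewrite HY (diff_coord _ df) addrACA.
Qed.

(** The argument on the right is the bracket [X, Y] in coordinates; the second-order terms of
    [diff_vfield] cancel. *)
Lemma diff_bracket n (f : 'rV[R]_2 -> 'rV[R]_n) X Y p :
  smooth D f -> smooth D X -> smooth D Y -> D p ->
  'd (fun q => 'd f q (Y q)) p (X p) - 'd (fun q => 'd f q (X q)) p (Y p)
  = 'd f p ('d Y p (X p) - 'd X p (Y p)).
Proof.
move=> Sf SX SY Dp.
have HX := diff_vfield (X p) Sf SY Dp.
have HY := diff_vfield (Y p) Sf SX Dp.
have HS := schwarz oD (X p) (Y p) Sf Dp.
apply: (etrans (congr2 (fun a b => a - b) HX HY)).
by rewrite HS /= opprD addrACA subrr addr0 (linearB ('d f p)).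
Qed.

End vector_fields.

(** * The shape operator in a frame *)

Section shape.
Context {R : realType}.

Lemma gram_dot (L L' : {linear 'rV[R]_2 -> 'rV[R]_3}) :
  gram (fun u v => dot (L u) (L' v)) = lin1_mx L *m (lin1_mx L')^T.
Proof. by apply/matrixP => i j; rewrite !mxE; apply: eq_bigr => k _; rewrite !mxE. Qed.

Lemma gram_opp (B : 'rV[R]_2 -> 'rV[R]_2 -> R) :
  gram (fun u v => - B u v) = - gram B.
Proof. by apply/matrixP => i j; rewrite !mxE. Qed.

Lemma det_mx22 (A : 'M[R]_2) : \det A = A 0 0 * A 1 1 - A 0 1 * A 1 0.
Proof.
rewrite (expand_det_row _ ord0) !big_ord_recl big_ord0 /cofactor !det_mx11 !mxE.
rewrite (_ : lift ord0 ord0 = 1); last exact: val_inj.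
rewrite (_ : lift 1 0 = 0); last exact: val_inj.
by rewrite addr0 expr0 mul1r expr1 mulN1r mulrN.
Qed.

Lemma det_block11 (a b c d : R) :
  \det (block_mx (a%:M : 'M[R]_1) (b%:M : 'M[R]_1) c%:M d%:M) = a * d - b * c.
Proof.
have E0 : (0 : 'I_2) = lshift 1 (0 : 'I_1) by exact: val_inj.
have E1 : (1 : 'I_2) = rshift 1 (0 : 'I_1) by exact: val_inj.
rewrite det_mx22 E0 E1 [X in X * _ - _]block_mxEul [X in _ * X - _]block_mxEdr.
rewrite [X in _ - X * _]block_mxEur [X in _ - _ * X]block_mxEdl.
by rewrite !mxE !mulr1n.
Qed.

Lemma mx11_dot n (u v : 'rV[R]_n) : u *m v^T = (dot u v)%:M.
Proof.
rewrite [LHS]mx11_scalar; congr _%:M; rewrite mxE.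
by apply: eq_bigr => i _; rewrite mxE.
Qed.

(** With the frame as rows of [M] and the coefficients in [C], one has [M *m JN = C *m (M *m J)].
    Hence [S] is conjugate to [- C], and its determinant and trace can be read off in any frame. *)
Lemma det_trace_frame (J JN : 'M[R]_(2, 3)) (u1 u3 : 'rV[R]_2)
    (f1 f3 n1 n3 : 'rV[R]_3) (a b c d : R) :
  u1 *m J = f1 -> u3 *m J = f3 -> u1 *m JN = n1 -> u3 *m JN = n3 ->
  dot f1 f1 * dot f3 f3 - dot f1 f3 ^+ 2 != 0 ->
  n1 = a *: f1 + b *: f3 -> n3 = c *: f1 + d *: f3 ->
  let S := - (JN *m J^T) *m invmx (J *m J^T) in
  \det S = a * d - b * c /\ \tr S = - (a + d).
Proof.
move=> <- <- <- <- G0 N1 N3 S.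
pose M : 'M[R]_(1 + 1, 2) := col_mx u1 u3.
pose C : 'M[R]_(1 + 1) := block_mx (a%:M : 'M[R]_1) (b%:M : 'M[R]_1) c%:M d%:M.
have MJ : M *m J = col_mx (u1 *m J) (u3 *m J) by rewrite mul_col_mx.
have MJN : M *m JN = C *m (M *m J).
  by rewrite MJ mul_col_mx mul_block_col !mul_scalar_mx N1 N3.
(* This product is the Gram matrix of the frame; its invertibility yields that of [M] and of
   [J *m J^T] at once. *)
have GU : (M *m (J *m J^T) *m M^T : 'M[R]_(1 + 1)) \in unitmx.
  rewrite mulmxA -mulmxA -trmx_mul MJ tr_col_mx mul_col_row !mx11_dot.
  rewrite unitmxE det_block11 unitfE.
  by rewrite (dotC (u3 *m J) (u1 *m J)) -expr2.
have := GU; rewrite !unitmx_mul => /andP[/andP[MU JU] _].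
have SE : S = - (invmx M *m C *m M).
  have JNE : JN = invmx M *m C *m M *m J by rewrite -!mulmxA -MJN mulKmx.
  by rewrite /S JNE -[X in - X *m _]mulmxA mulNmx mulmxK.
split.
  rewrite SE -scaleN1r detZ sqrrN expr1n mul1r !det_mulmx.
  by rewrite det_inv mulrAC mulVf ?mul1r ?det_block11// -unitfE -unitmxE.
rewrite SE linearN/= mxtrace_mulC mulmxA mulmxV// mul1mx.
by rewrite mxtrace_block !mxtrace_scalar.
Qed.

Lemma shape_frame (f N : 'rV[R]_2 -> 'rV[R]_3) p u1 u3 a b c d :
  fundI f p u1 u1 * fundI f p u3 u3 - fundI f p u1 u3 ^+ 2 != 0 ->
  'd N p u1 = a *: 'd f p u1 + b *: 'd f p u3 ->
  'd N p u3 = c *: 'd f p u1 + d *: 'd f p u3 ->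
  gauss_curvature f N p = a * d - b * c /\
  mean_curvature f N p = - (a + d) / 2.
Proof.
move=> H0 H1 H3; pose J := lin1_mx ('d f p); pose JN := lin1_mx ('d N p).
have GI : gram (fundI f p) = J *m J^T by exact: gram_dot.
have GII : gram (fundII f N p) = - (JN *m J^T).
  exact: (etrans (gram_opp _) (congr1 -%R (gram_dot _ _))).
have SE : shape_mx f N p = - (JN *m J^T) *m invmx (J *m J^T).
  exact: (congr2 (fun A B => A *m invmx B) GII GI).
have [dE tE] := det_trace_frame (mul_rV_lin1 ('d f p) u1) (mul_rV_lin1 ('d f p) u3)
  (mul_rV_lin1 ('d N p) u1) (mul_rV_lin1 ('d N p) u3) H0 H1 H3.
split; first exact: (etrans (congr1 determinant SE) dE).
exact: (congr1 (fun x => x / 2) (etrans (congr1 mxtrace SE) tE)).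
Qed.

End shape.

(** * Triple products and oblique frames in space *)

Section space_frame.
Context {R : realType}.
Implicit Types u v w X Y : 'rV[R]_3.

Lemma dot3 u v : dot u v = u 0 0 * v 0 0 + u 0 1 * v 0 1 + u 0 2%:R * v 0 2%:R.
Proof.
rewrite /dot !big_ord_recl big_ord0 addr0 addrA.
rewrite (_ : lift ord0 (lift ord0 ord0) = 2%:R); last exact: val_inj.
by rewrite (_ : lift ord0 ord0 = 1); last exact: val_inj.
Qed.

Lemma row3P u v : u 0 0 = v 0 0 -> u 0 1 = v 0 1 -> u 0 2%:R = v 0 2%:R -> u = v.
Proof.
move=> e0 e1 e2; apply/rowP => -[[|[|[|//]]] i3].
- by rewrite (_ : Ordinal i3 = 0); last exact: val_inj.
- by rewrite (_ : Ordinal i3 = 1); last exact: val_inj.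
- by rewrite (_ : Ordinal i3 = 2%:R); last exact: val_inj.
Qed.

Definition det3 u v w : R :=
  u 0 0 * (v 0 1 * w 0 2%:R - v 0 2%:R * w 0 1)
  - u 0 1 * (v 0 0 * w 0 2%:R - v 0 2%:R * w 0 0)
  + u 0 2%:R * (v 0 0 * w 0 1 - v 0 1 * w 0 0).

Lemma crossE u v :
  [/\ cross u v 0 0 = u 0 1 * v 0 2%:R - u 0 2%:R * v 0 1,
      cross u v 0 1 = u 0 2%:R * v 0 0 - u 0 0 * v 0 2%:R &
      cross u v 0 2%:R = u 0 0 * v 0 1 - u 0 1 * v 0 0].
Proof.
rewrite !mxE.
rewrite (_ : 0 + 1 = 1 :> 'I_3); last exact: val_inj.
rewrite (_ : 0 + 2%:R = 2%:R :> 'I_3); last exact: val_inj.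
rewrite (_ : 1 + 1 = 2%:R :> 'I_3); last exact: val_inj.
rewrite (_ : 1 + 2%:R = 0 :> 'I_3); last exact: val_inj.
rewrite (_ : 2%:R + 1 = 0 :> 'I_3); last exact: val_inj.
by rewrite (_ : 2%:R + 2%:R = 1 :> 'I_3); last exact: val_inj.
Qed.

Lemma dot_cross u v w : dot (cross u v) w = det3 u v w.
Proof. rewrite dot3 /det3; have [-> -> ->] := crossE u v; ring. Qed.

(** Cramer's rule without division: up to the determinant, the cross products form the basis dual to
    [u], [v], [w]. *)
Lemma det3_cramer u v w X : det3 u v w *: X =
  dot X u *: cross v w + dot X v *: cross w u + dot X w *: cross u v.
Proof.
have [vw0 vw1 vw2] := crossE v w; have [wu0 wu1 wu2] := crossE w u.
have [uv0 uv1 uv2] := crossE u v; rewrite /det3 !dot3.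
have lin (a b c : R) x y z k : (a *: x + b *: y + c *: z : 'rV[R]_3) 0 k =
    a * x 0 k + b * y 0 k + c * z 0 k by rewrite !mxE.
have scal (a : R) (x : 'rV[R]_3) k : (a *: x) 0 k = a * x 0 k by rewrite mxE.
by apply: row3P; rewrite lin scal ?(vw0, vw1, vw2, wu0, wu1, wu2, uv0, uv1, uv2); ring.
Qed.

(** The right-hand side is the Gram determinant of the three vectors. *)
Lemma det3_gram u v w : det3 u v w ^+ 2 =
  dot u u * (dot v v * dot w w - dot v w ^+ 2)
  - dot u v * (dot u v * dot w w - dot v w * dot u w)
  + dot u w * (dot u v * dot v w - dot v v * dot u w).
Proof. rewrite /det3 !dot3; ring. Qed.

Lemma det3_comb a b c u v w X Y : det3 (a *: u + b *: v + c *: w) X Y =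
  a * det3 u X Y + b * det3 v X Y + c * det3 w X Y.
Proof. by rewrite /det3 !mxE; ring. Qed.

Lemma det3_alt u v : [/\ det3 u u v = 0, det3 u v u = 0 & det3 v u u = 0].
Proof. by split; rewrite /det3; ring. Qed.

Lemma det3_perm u v w : [/\ det3 v u w = - det3 u v w,
  det3 w v u = - det3 u v w & det3 w u v = det3 u v w].
Proof. by split; rewrite /det3; ring. Qed.

End space_frame.

Section moving_frame.
Context {R : realType}.
Variables (p1 p3 n : 'rV[R]_3) (co : R).
Hypotheses (p11 : dot p1 p1 = 1) (p33 : dot p3 p3 = 1) (nn : dot n n = 1).
Hypotheses (np1 : dot n p1 = 0) (np3 : dot n p3 = 0) (p13 : dot p1 p3 = co).
Hypothesis co1 : 1 - co ^+ 2 != 0.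

Lemma det3_frame : det3 p1 p3 n != 0.
Proof.
rewrite -sqrf_eq0 det3_gram p11 p33 nn p13 (dotC p1) (dotC p3) np1 np3.
by move: co1; congr (_ != 0); ring.
Qed.

Lemma frame_eq0 Y : dot Y p1 = 0 -> dot Y p3 = 0 -> dot Y n = 0 -> Y = 0.
Proof.
move=> y1 y3 yn; apply: (scalerI det3_frame).
by rewrite det3_cramer y1 y3 yn !scale0r !addr0 scaler0.
Qed.

(** The denominators come from inverting the Gram matrix of the oblique unit pair [p1], [p3]. *)
Lemma frame_decomp X : X =
  ((dot X p1 - co * dot X p3) / (1 - co ^+ 2)) *: p1 +
  ((dot X p3 - co * dot X p1) / (1 - co ^+ 2)) *: p3 + dot X n *: n.
Proof.
apply/eqP; rewrite -subr_eq0; apply/eqP; apply: frame_eq0.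
- rewrite dotDl dotNl !dotDl !dotZl p11 (dotC p3) p13 np1; field.
  exact: co1.
- rewrite dotDl dotNl !dotDl !dotZl p33 p13 np3; field.
  exact: co1.
- rewrite dotDl dotNl !dotDl !dotZl (dotC p1) (dotC p3) np1 np3 nn; ring.
Qed.

End moving_frame.

(** * Moving frames *)

Section rules.
Context {R : realType} {D : set 'rV[R]_2} (oD : open D).

Lemma dot_rule n (f g : 'rV[R]_2 -> 'rV[R]_n) h p v :
  smooth D f -> smooth D g -> (forall q, D q -> dot (f q) (g q) = h q) -> D p ->
  dot ('d f p v) (g p) + dot (f p) ('d g p v) = 'd h p v.
Proof.
move=> Sf Sg fg Dp.
have Sfg : smooth D (fun q => dot (f q) (g q)) by move=> k; exact: Ck_dot.
apply: (etrans _ (diff_eq_on oD v Sfg Dp fg)); apply/esym/diff_dot.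
  exact: smooth_differentiable Dp.
exact: smooth_differentiable Dp.
Qed.

Lemma dot_rule_cst n (f g : 'rV[R]_2 -> 'rV[R]_n) a p v :
  smooth D f -> smooth D g -> (forall q, D q -> dot (f q) (g q) = a) -> D p ->
  dot ('d f p v) (g p) + dot (f p) ('d g p v) = 0.
Proof.
move=> Sf Sg fg Dp; rewrite (dot_rule (h := cst a))//.
exact: (congr1 (@^~ v) (diff_cst a p)).
Qed.

Lemma diff_cos (om : 'rV[R]_2 -> R) p v : smooth D om -> D p ->
  'd (fun q => cos (om q)) p v = - sin (om p) * 'd om p v.
Proof.
move=> Som Dp; have dom := smooth_differentiable Som Dp.
have [dc E] := derive_comp_real v dom (is_derive_cos (om p)).
exact: (etrans (esym (deriveE v dc)) (etrans E (congr1 _ (deriveE v dom)))).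
Qed.

Lemma diff_sin (om : 'rV[R]_2 -> R) p v : smooth D om -> D p ->
  'd (fun q => sin (om q)) p v = cos (om p) * 'd om p v.
Proof.
move=> Som Dp; have dom := smooth_differentiable Som Dp.
have [dc E] := derive_comp_real v dom (is_derive_sin (om p)).
exact: (etrans (esym (deriveE v dc)) (etrans E (congr1 _ (deriveE v dom)))).
Qed.

Lemma smooth_sin (om : 'rV[R]_2 -> R) :
  smooth D om -> smooth D (fun q => sin (om q)).
Proof. by move=> Som k; have [] := Ck_sin_cos oD (Som k). Qed.

Lemma smoothN {V : normedModType R} (f : 'rV[R]_2 -> V) :
  smooth D f -> smooth D (fun q => - f q).
Proof. by move=> Sf k; exact: CkN. Qed.

Lemma diff_opp {V : normedModType R} (f : 'rV[R]_2 -> V) p v :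
  differentiable f p -> 'd (fun q => - f q) p v = - 'd f p v.
Proof. by move=> df; exact: (congr1 (@^~ v) (diffN df)). Qed.

(** In the application [a], [x] are the inner products of E1 p1 with [p3] and of E1 p3 with [p1];
    [e], [y] those of E3 p3 with [p1] and of E3 p1 with [p3]; [m1], [m3] belong to E1 n3 and [l1],
    [l3] to E3 n1; [t] and [k] are cot and csc. Eliminating [a] and [e] removes [w1] and [w3] as
    well. What remains is a homogeneous system in [al], [be] whose determinant is a nonzero multiple
    of [s ^+ 2]. *)
Lemma chebyshev_coeffs (s co w1 w3 t k al be a e x y m1 m3 l1 l3 : R) :
  s != 0 -> s ^+ 2 = 1 - co ^+ 2 -> s * k = 1 -> s * t = co ->
  a + x = - s * w1 -> y + e = - s * w3 ->
  x = al + be * co -> - y = al * co + be ->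
  m1 - l1 = - be * s -> m3 - l3 = - al * s ->
  m1 + t * a = - co * w1 -> l3 + t * e = - co * w3 ->
  m3 - k * x = 0 -> l1 - k * y = 0 ->
  al = 0 /\ be = 0.
Proof.
move=> s0 s2 sk st ax ye xE yE b1 b3 r7 r8 r9 r10.
have sm1 : s * m1 = co * x.
  have -> : m1 = - co * w1 - t * a by rewrite -r7; ring.
  have -> : a = - s * w1 - x by rewrite -ax; ring.
  by rewrite -st; ring.
have sl3 : s * l3 = co * y.
  have -> : l3 = - co * w3 - t * e by rewrite -r8; ring.
  have -> : e = - s * w3 - y by rewrite -ye; ring.
  by rewrite -st; ring.
have sm3 : s * m3 = x.
  by have -> : m3 = k * x by [apply/eqP; rewrite -subr_eq0 r9]; rewrite mulrA sk mul1r.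
have sl1 : s * l1 = y.
  by have -> : l1 = k * y by [apply/eqP; rewrite -subr_eq0 r10]; rewrite mulrA sk mul1r.
have c1 : co * x - y = - be * s ^+ 2.
  by rewrite -sm1 -sl1 -mulrBr b1; ring.
have c3 : x - co * y = - al * s ^+ 2.
  by rewrite -sm3 -sl3 -mulrBr b3; ring.
have {yE}yE : y = - (al * co + be) by rewrite -yE opprK.
rewrite xE yE s2 in c1 c3.
have beE : be = - (al * co) by lra.
have al0 : al * s ^+ 2 = 0 by rewrite s2; rewrite beE in c3; lra.
have {al0}al0 : al = 0.
  by apply/eqP; move/eqP: al0; rewrite mulf_eq0 expf_eq0/= (negbTE s0) orbF.
by rewrite al0 mul0r oppr0 in beE.
Qed.

Lemma eq_addr0 (a b c : R) : b = 0 -> a + b = c -> a = c.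
Proof. by move=> ->; rewrite addr0. Qed.

Lemma eq_add0r (a b c : R) : a = 0 -> a + b = c -> b = c.
Proof. by move=> ->; rewrite add0r. Qed.

Lemma dot_diag n (u v : 'rV[R]_n) : dot u v + dot v u = 0 -> dot u v = 0.
Proof. by rewrite (dotC v); lra. Qed.

Lemma unit_normal_derive n (N : 'rV[R]_2 -> 'rV[R]_n) p v : smooth D N ->
  (forall q, D q -> dot (N q) (N q) = 1) -> D p -> dot ('d N p v) (N p) = 0.
Proof. by move=> SN NN Dp; apply: dot_diag; exact: (dot_rule_cst v SN SN NN Dp). Qed.

(* d_ij and e_ij stand for the derivatives of p_j and n_j along E_i, w_i for
   that of omega, and al, be for the coordinates of [E1, E3]. *)
Lemma bracket_eq0 (s co w1 w3 al be : R)
    (p1 p3 n1 n3 d11 d13 d31 d33 e13 e31 : 'rV[R]_3) :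
  s != 0 -> s ^+ 2 = 1 - co ^+ 2 ->
  dot p1 p1 = 1 -> dot p3 p3 = 1 -> dot p1 p3 = co ->
  dot n1 p1 = 0 -> dot n3 p3 = 0 -> dot n1 p3 = - s -> dot n3 p1 = - s ->
  n1 = (co / s) *: p1 - s^-1 *: p3 -> n3 = (co / s) *: p3 - s^-1 *: p1 ->
  d13 - d31 = al *: p1 + be *: p3 -> e13 - e31 = al *: n1 + be *: n3 ->
  dot d11 p1 = 0 -> dot d31 p1 = 0 -> dot d13 p3 = 0 -> dot d33 p3 = 0 ->
  dot d11 p3 + dot p1 d13 = - s * w1 -> dot d31 p3 + dot p1 d33 = - s * w3 ->
  dot e13 p1 + dot n3 d11 = - co * w1 -> dot e31 p3 + dot n1 d33 = - co * w3 ->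
  dot e13 p3 + dot n3 d13 = 0 -> dot e31 p1 + dot n1 d31 = 0 ->
  al = 0 /\ be = 0.
Proof.
move=> s0 s2 p11 p33 p13 np11 np33 np13 np31 n1E n3E dE eE r1 r2 r3 r4.
have d1 := congr1 (fun X => dot X p1) dE; have d3 := congr1 (fun X => dot X p3) dE.
have e1 := congr1 (fun X => dot X p1) eE; have e3 := congr1 (fun X => dot X p3) eE.
move: d1 d3 e1 e3; rewrite /= !dotDl !dotNl !dotZl (dotC p3 p1) p11 p33 p13.
rewrite np11 np33 np13 np31 r2 r3 => d1 d3 e1 e3.
rewrite !(dotC p1) n1E n3E !dotDl !dotNl !dotZl !(dotC p1) !(dotC p3) r1 r2 r3 r4.
move=> r5 r6 r7 r8 r9 r10.
apply: (@chebyshev_coeffs s co w1 w3 (co / s) s^-1 al be (dot d11 p3) (dot d33 p1)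
  (dot d13 p1) (dot d31 p3) (dot e13 p1) (dot e13 p3) (dot e31 p1) (dot e31 p3)) => //.
- by rewrite mulfV.
- by rewrite mulrC divfK.
- by move: d1; lra.
- by move: d3; lra.
- by move: e1; lra.
- by move: e3; lra.
- by rewrite -r7; ring.
- by rewrite -r8; ring.
- by rewrite -r9; ring.
- by rewrite -r10; ring.
Qed.

(* Same notation as in [bracket_eq0]; dd33 is E1 (E3 p3) and h is E1 (E3 omega). *)
Lemma gauss_equation (s co w1 w3 h : R) (p1 p3 n n1 d11 d13 d33 dd33 : 'rV[R]_3) :
  s != 0 -> s ^+ 2 = 1 - co ^+ 2 -> 1 - co ^+ 2 != 0 ->
  dot p1 p1 = 1 -> dot p3 p3 = 1 -> dot n n = 1 ->
  dot n p1 = 0 -> dot n p3 = 0 -> dot p1 p3 = co -> dot n1 p3 = - s ->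
  dot d11 p1 = 0 -> dot d11 p3 = - s * w1 ->
  dot d33 p3 = 0 -> dot d33 p1 = - s * w3 ->
  dot d13 p1 = 0 -> dot d13 p3 = 0 ->
  dot n1 p3 + dot n d13 = 0 -> dot n d33 = 0 ->
  dot dd33 p1 + dot d13 d13 = 0 ->
  dot dd33 p1 + dot d33 d11 = - (co * w1 * w3 + s * h) ->
  h = s.
Proof.
move=> s0 s2 co1 p11 p33 nn np1 np3 p13 np13 a1 a3 b3 b1 c1 c3 nd13 nd33 dd e.
have dec := frame_decomp p11 p33 nn np1 np3 p13 co1.
(* The mixed derivative has no tangential part, so [d13] is [s] times the normal; its square is the
   source of the right-hand side of the sine-Gordon equation. *)
have c13 : dot d13 d13 = s ^+ 2.
  rewrite [X in dot X _](dec d13) c1 c3 !dotDl !dotZl !(dotC p1) !(dotC p3) c1 c3.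
  rewrite (dotC d13); have -> : dot n d13 = s by lra.
  by ring.
have c33 : dot d33 d11 = - co * w1 * w3.
  rewrite [X in dot X _](dec d33) b1 b3 (dotC d33) nd33 !dotDl !dotZl.
  rewrite !(dotC p1) !(dotC p3) a1 a3 -s2; field.
  exact: s0.
have : s * h = s * s by rewrite c13 in dd; rewrite c33 in e; move: dd e; rewrite expr2; lra.
exact: (mulfI s0).
Qed.

Lemma compatibility_coeffs (s co w1 w3 b c B1 C3 : R) (p1 p3 d11 d33 : 'rV[R]_3) :
  s != 0 -> s ^+ 2 = 1 - co ^+ 2 ->
  dot p1 p1 = 1 -> dot p3 p3 = 1 -> dot p1 p3 = co ->
  dot d11 p1 = 0 -> dot d11 p3 = - s * w1 ->
  dot d33 p3 = 0 -> dot d33 p1 = - s * w3 ->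
  B1 *: p1 + b *: d11 = C3 *: p3 + c *: d33 ->
  - B1 = c * s^-1 * w3 + b * (co / s) * w1 /\
  - C3 = c * (co / s) * w3 + b * s^-1 * w1.
Proof.
move=> s0 s2 p11 p33 p13 a1 a3 b3 b1 E.
have e1 := congr1 (fun X => dot X p1) E; have e3 := congr1 (fun X => dot X p3) E.
move: e1 e3; rewrite /= !dotDl !dotZl (dotC p3 p1) p11 p33 p13 a1 a3 b1 b3.
rewrite mulr1 !mulr0 !addr0 mulr1 => e1 e3.
(* Subtracting [co] times the pairing with [p3] from the pairing with [p1] eliminates [C3]. *)
have sB : B1 * s ^+ 2 = - s * (c * w3 + b * co * w1).
  transitivity (B1 - co * (B1 * co)); first by rewrite s2; ring.
  have -> : B1 * co = C3 - b * (- s * w1) by rewrite -e3 addrK.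
  by rewrite {1}e1; ring.
have B1E : B1 = - (c * w3 + b * co * w1) / s.
  by apply: (mulIf (expf_neq0 2 s0)); rewrite sB; field.
split; first by rewrite B1E; field.
rewrite -e3 B1E; apply: (mulIf s0); transitivity
  ((c * w3 * co + b * w1 * (co ^+ 2 + s ^+ 2))); first by field.
by rewrite s2; field.
Qed.

End rules.

(** * Rotation fields *)

Section rotation.
Context {R : realType} {D : set 'rV[R]_2} (oD : open D).

Lemma diff_entry m n (f : 'rV[R]_2 -> 'M[R]_(m, n)) p v i j :
  smooth D f -> D p -> 'd (fun q => f q i j) p v = ('d f p v) i j.
Proof.
move=> Sf Dp; have df := smooth_differentiable Sf Dp.
have Sfij : smooth D (fun q => f q i j) by move=> k; exact: Ck_coord.
apply: (etrans (esym (deriveE v (smooth_differentiable Sfij Dp)))).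
apply: (etrans (esym (derive_coord v i j df))).
exact: (congr1 (fun A : 'M[R]_(m, n) => A i j) (deriveE v df)).
Qed.

Lemma diff_entryM n (f g : 'rV[R]_2 -> 'rV[R]_n) p v i j :
  smooth D f -> smooth D g -> D p ->
  differentiable (fun q => f q 0 i * g q 0 j) p /\
  'd (fun q => f q 0 i * g q 0 j) p v =
    ('d f p v) 0 i * g p 0 j + f p 0 i * ('d g p v) 0 j.
Proof.
move=> Sf Sg Dp.
have Sfi : smooth D (fun q => f q 0 i) by move=> k; exact: Ck_coord.
have Sgj : smooth D (fun q => g q 0 j) by move=> k; exact: Ck_coord.
have [dfg H] := differentiable_scale (smooth_differentiable Sfi Dp)
  (smooth_differentiable Sgj Dp).
split; first exact: dfg.
apply: (etrans (H v)).
exact: (congr2 (fun x y => x * g p 0 j + f p 0 i * y)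
  (diff_entry v 0 i Sf Dp) (diff_entry v 0 j Sg Dp)).
Qed.

Lemma cross_product_rule (u v x y : 'rV[R]_3) k :
  (x 0 (k + 1) * v 0 (k + 2%:R) + u 0 (k + 1) * y 0 (k + 2%:R)) -
  (x 0 (k + 2%:R) * v 0 (k + 1) + u 0 (k + 2%:R) * y 0 (k + 1)) =
  cross x v 0 k + cross u y 0 k.
Proof. by rewrite !mxE; ring. Qed.

Lemma diff_cross (f g : 'rV[R]_2 -> 'rV[R]_3) p v k :
  smooth D f -> smooth D g -> D p ->
  'd (fun q => cross (f q) (g q) 0 k) p v =
  cross ('d f p v) (g p) 0 k + cross (f p) ('d g p v) 0 k.
Proof.
move=> Sf Sg Dp.
have [d1 e1] := diff_entryM v (k + 1) (k + 2%:R) Sf Sg Dp.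
have [d2 e2] := diff_entryM v (k + 2%:R) (k + 1) Sf Sg Dp.
have E : (fun q => cross (f q) (g q) 0 k) =
    (fun q => f q 0 (k + 1) * g q 0 (k + 2%:R)) -
    (fun q => f q 0 (k + 2%:R) * g q 0 (k + 1)).
  by apply/funext => q; rewrite mxE.
apply: (etrans (congr1 (fun h : 'rV[R]_2 -> R => 'd h p v) E)).
apply: (etrans (congr1 (@^~ v) (diffB d1 d2))).
apply: (etrans (congr2 (fun x y : R => x - y) e1 e2)).
exact: cross_product_rule.
Qed.

(** When the equation for [xi] is differentiated once more, the second derivatives of [xi] and of
    [psi] are symmetric and drop out of the difference. *)
Lemma rotation_compat (psi eta xi : 'rV[R]_2 -> 'rV[R]_3) p u v :
  smooth D psi -> smooth D eta -> smooth D xi ->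
  (forall q, D q -> forall w, 'd xi q w = cross (eta q) ('d psi q w)) -> D p ->
  cross ('d eta p u) ('d psi p v) = cross ('d eta p v) ('d psi p u).
Proof.
move=> Spsi Seta Sxi xiE Dp.
have key w z k : ('D_w ('D_z xi) p) 0 k = cross ('d eta p w) ('d psi p z) 0 k
    + cross (eta p) ('D_w ('D_z psi) p) 0 k.
  have SDxi := smooth_derive z Sxi; have SDpsi := smooth_derive z Spsi.
  have SDk : smooth D (fun q => 'D_z xi q 0 k) by move=> j; exact: Ck_coord.
  have E q : D q -> 'D_z xi q 0 k = cross (eta q) ('D_z psi q) 0 k.
    move=> Dq; have xiq := etrans (deriveE z (smooth_differentiable Sxi Dq)) (xiE q Dq z).
    have psiq := esym (deriveE z (smooth_differentiable Spsi Dq)).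
    exact: (congr1 (fun A : 'rV[R]_3 => A 0 k)
      (etrans xiq (congr1 (cross (eta q)) psiq))).
  have L := etrans (diff_entry w 0 k SDxi Dp)
    (congr1 (fun A : 'rV_3 => A 0 k) (esym (deriveE w (smooth_differentiable SDxi Dp)))).
  apply: (etrans (esym L)); apply: (etrans (diff_eq_on oD w SDk Dp E)).
  apply: (etrans (diff_cross w k Seta SDpsi Dp)).
  have e1 := deriveE z (smooth_differentiable Spsi Dp).
  have e2 := deriveE w (smooth_differentiable SDpsi Dp).
  exact: (congr2 (fun X Y => cross ('d eta p w) X 0 k + cross (eta p) Y 0 k) e1 (esym e2)).
apply/rowP => k; have := etrans (esym (key u v k))
  (etrans (congr1 (fun A : 'rV_3 => A 0 k) (schwarz oD u v Sxi Dp)) (key v u k)).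
have H := congr1 (fun A => cross (eta p) A 0 k) (schwarz oD u v Spsi Dp).
move=> E; apply: (addIr (cross (eta p) ('D_u ('D_v psi) p) 0 k)).
exact: (etrans E (congr1 (fun x => cross ('d eta p v) ('d psi p u) 0 k + x) (esym H))).
Qed.

(** Differentiating the orthogonality of [N] and ['D_z f] moves a derivative from [N] to [f], where
    derivatives commute. It serves for [psi] and for [eta]. *)
Lemma fundII_sym (f N : 'rV[R]_2 -> 'rV[R]_3) p u v :
  smooth D f -> smooth D N ->
  (forall q, D q -> forall w, dot (N q) ('d f q w) = 0) -> D p ->
  dot ('d N p u) ('d f p v) = dot ('d N p v) ('d f p u).
Proof.
move=> Sf SN Nf Dp.
have key w z : dot ('d N p w) ('d f p z) = - dot (N p) ('D_w ('D_z f) p).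
  have SDf := smooth_derive z Sf.
  have E q : D q -> dot (N q) ('D_z f q) = 0.
    move=> Dq; apply: (etrans _ (Nf q Dq z)).
    exact: (congr1 (dot (N q)) (deriveE z (smooth_differentiable Sf Dq))).
  have := dot_rule_cst oD w SN SDf E Dp => /eqP; rewrite addr_eq0 => /eqP H.
  apply: (etrans (congr1 (dot _) (esym (deriveE z (smooth_differentiable Sf Dp))))).
  apply: (etrans H).
  exact: (congr1 (fun X => - dot (N p) X)
    (esym (deriveE w (smooth_differentiable SDf Dp)))).
apply: (etrans (key u v)); apply: (etrans _ (esym (key v u))).
exact: (congr1 (fun X => - dot (N p) X) (schwarz oD u v Sf Dp)).
Qed.

Section rotation_algebra.
Variables (co : R) (p1 p3 n h1 h3 : 'rV[R]_3).
Hypotheses (p11 : dot p1 p1 = 1) (p33 : dot p3 p3 = 1) (nn : dot n n = 1).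
Hypotheses (np1 : dot n p1 = 0) (np3 : dot n p3 = 0) (p13 : dot p1 p3 = co).
Hypothesis co1 : 1 - co ^+ 2 != 0.
Hypothesis hx : cross h3 p1 = cross h1 p3.

Let dec := frame_decomp p11 p33 nn np1 np3 p13 co1.
Let d0 := det3_frame p11 p33 nn np1 np3 p13 co1.

(** Pairing [hx] with [p1] or [p3] kills one side; on the other, tangential components give
    determinants with a repeated vector, so only the normal component survives. *)
Lemma rotation_tangent : dot h1 n = 0 /\ dot h3 n = 0.
Proof.
have h1E := dec h1; have h3E := dec h3; move: h1E h3E.
move: ((dot h1 p1 - _) / _) ((dot h1 p3 - _) / _) (dot h1 n) => a1 c m1 h1E.
move: ((dot h3 p1 - _) / _) ((dot h3 p3 - _) / _) (dot h3 n) => b a3 m3 h3E.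
have := congr1 (fun X => dot X p3) hx; have := congr1 (fun X => dot X p1) hx.
rewrite /= !dot_cross h1E h3E !det3_comb.
have [z1 z2 z3] := det3_alt p1 p3; have [y1 y2 y3] := det3_alt p3 p1.
have [_ _ x3] := det3_alt p1 n; have [_ _ w3] := det3_alt p3 n.
have [u1 _ _] := det3_alt p1 p1; have [u3 _ _] := det3_alt p3 p3.
have [_ v2 v3] := det3_perm p1 p3 n.
rewrite z1 z2 z3 y1 y2 y3 x3 w3 u1 u3 v2 v3 !mulr0 !addr0 !add0r => m1E m3E.
by split; apply: (mulIf d0); lra.
Qed.

Lemma rotation_coeffs (s : R) (n1 n3 : 'rV[R]_3) : s != 0 ->
  dot n1 p1 = 0 -> dot n3 p3 = 0 -> dot n1 p3 = - s -> dot n3 p1 = - s ->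
  dot n1 h3 = dot n3 h1 ->
  h1 = ((dot h1 p3 - co * dot h1 p1) / (1 - co ^+ 2)) *: p3 /\
  h3 = ((dot h3 p1 - co * dot h3 p3) / (1 - co ^+ 2)) *: p1.
Proof.
move=> s0 np11 np33 np13 np31 hn; have [m1 m3] := rotation_tangent.
have h1E := dec h1; have h3E := dec h3.
set c := (dot h1 p3 - _) / _ in h1E *; set b := (dot h3 p1 - _) / _ in h3E *.
move: h1E h3E; rewrite m1 m3.
move: ((dot h1 p1 - _) / _) ((dot h3 p3 - _) / _) => a1 a3 h1E h3E.
(* The pairing with [n] is the trace condition [- a3 = a1], while [hn] amounts to [a3 = a1]. *)
have := congr1 (fun X => dot X n) hx; move: hn; rewrite /= !dot_cross.
move: b c h3E h1E => b c -> ->; rewrite !det3_comb.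
rewrite !dotDr !dotZr np11 np33 np13 np31 !scale0r !addr0 => hn.
have [x1 _ _] := det3_alt p1 n; have [w1 _ _] := det3_alt p3 n.
have [v1 _ _] := det3_perm p1 p3 n.
rewrite x1 w1 v1 !mul0r !mulr0 !addr0 !add0r => a13.
have {}a13 : - a3 = a1 by apply: (mulIf d0); lra.
have a10 : a1 = 0 by apply: (mulIf s0); move: hn; rewrite -a13; lra.
have a30 : a3 = 0 by lra.
by rewrite a10 a30 !scale0r !addr0 !add0r.
Qed.

End rotation_algebra.

End rotation.

(** * K-surfaces *)

Section K_surface_calculus.
Context {R : realType} {D : set 'rV[R]_2} (oD : open D).
Variables (psi N P1 P3 N1 N3 : 'rV[R]_2 -> 'rV[R]_3).
Variables (E1 E3 : 'rV[R]_2 -> 'rV[R]_2) (omega : 'rV[R]_2 -> R).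
Hypotheses (Spsi : smooth D psi) (SN : smooth D N).
Hypotheses (SE1 : smooth D E1) (SE3 : smooth D E3) (Som : smooth D omega).
Hypotheses (P1E : P1 = fun q => 'd psi q (E1 q)) (P3E : P3 = fun q => 'd psi q (E3 q)).
Hypotheses (N1E : N1 = fun q => 'd N q (E1 q)) (N3E : N3 = fun q => 'd N q (E3 q)).
Hypothesis sin_gt0 : forall q, D q -> 0 < sin (omega q).
Hypothesis span : forall q, D q -> forall u, exists al be, u = al *: E1 q + be *: E3 q.
Hypothesis NN : forall q, D q -> dot (N q) (N q) = 1.
Hypothesis NP1 : forall q, D q -> dot (N q) (P1 q) = 0.
Hypothesis NP3 : forall q, D q -> dot (N q) (P3 q) = 0.
Hypothesis P11 : forall q, D q -> dot (P1 q) (P1 q) = 1.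
Hypothesis P33 : forall q, D q -> dot (P3 q) (P3 q) = 1.
Hypothesis P13 : forall q, D q -> dot (P1 q) (P3 q) = cos (omega q).
Hypothesis NP11 : forall q, D q -> dot (N1 q) (P1 q) = 0.
Hypothesis NP33 : forall q, D q -> dot (N3 q) (P3 q) = 0.
(** The condition K = -1 enters this section through this value and the next one. *)
Hypothesis NP13 : forall q, D q -> dot (N1 q) (P3 q) = - sin (omega q).
Hypothesis NP31 : forall q, D q -> dot (N3 q) (P1 q) = - sin (omega q).

Lemma smoothP1 : smooth D P1. Proof. by rewrite P1E; exact: smooth_diff. Qed.
Lemma smoothP3 : smooth D P3. Proof. by rewrite P3E; exact: smooth_diff. Qed.
Lemma smoothN1 : smooth D N1. Proof. by rewrite N1E; exact: smooth_diff. Qed.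
Lemma smoothN3 : smooth D N3. Proof. by rewrite N3E; exact: smooth_diff. Qed.
Let SP1 := smoothP1. Let SP3 := smoothP3.
Let SN1 := smoothN1. Let SN3 := smoothN3.

Lemma sin2_neq0 q : D q -> 1 - cos (omega q) ^+ 2 != 0.
Proof. by move=> Dq; rewrite -sin2cos2 expf_neq0// gt_eqF// sin_gt0. Qed.

Lemma normal_derive1 q : D q ->
  N1 q = cot (omega q) *: P1 q - csc (omega q) *: P3 q.
Proof.
move=> Dq; have s0 : sin (omega q) != 0 by rewrite gt_eqF// sin_gt0.
have n1 : dot (N1 q) (N q) = 0 by rewrite N1E; exact: unit_normal_derive NN Dq.
rewrite [LHS](frame_decomp (P11 Dq) (P33 Dq) (NN Dq) (NP1 Dq) (NP3 Dq) (P13 Dq)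
  (sin2_neq0 Dq)) n1 NP11// NP13// scale0r addr0 -sin2cos2 /cot /csc.
by rewrite -[X in _ = _ + X]scaleNr; congr (_ *: _ + _ *: _); field.
Qed.

Lemma normal_derive3 q : D q ->
  N3 q = cot (omega q) *: P3 q - csc (omega q) *: P1 q.
Proof.
move=> Dq; have s0 : sin (omega q) != 0 by rewrite gt_eqF// sin_gt0.
have n3 : dot (N3 q) (N q) = 0 by rewrite N3E; exact: unit_normal_derive NN Dq.
rewrite [LHS](frame_decomp (P11 Dq) (P33 Dq) (NN Dq) (NP1 Dq) (NP3 Dq) (P13 Dq)
  (sin2_neq0 Dq)) n3 NP33// NP31// scale0r addr0 -sin2cos2 /cot /csc [LHS]addrC.
by rewrite -[X in _ = _ + X]scaleNr; congr (_ *: _ + _ *: _); field.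
Qed.

Lemma frame_commutes p : D p -> 'd E3 p (E1 p) - 'd E1 p (E3 p) = 0.
Proof.
move=> Dp; have s0 : sin (omega p) != 0 by rewrite gt_eqF// sin_gt0.
have [al [be Z]] := span Dp ('d E3 p (E1 p) - 'd E1 p (E3 p)).
(* The bracket lives on the domain, so the same [al], [be] serve for [psi] and for [N]. *)
have br f f1 f3 : smooth D f -> f1 = (fun q => 'd f q (E1 q)) ->
    f3 = (fun q => 'd f q (E3 q)) ->
    'd f3 p (E1 p) - 'd f1 p (E3 p) = al *: f1 p + be *: f3 p :> 'rV[R]_3.
  move=> Sf -> ->; apply: (etrans (diff_bracket oD Sf SE1 SE3 Dp)).
  by rewrite Z linearD !linearZ.
have bP := br _ _ _ Spsi P1E P3E; have bN := br _ _ _ SN N1E N3E.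
have SnegS := smoothN oD (smooth_sin oD Som).
have diff_nsin v : 'd (fun q => - sin (omega q)) p v = - cos (omega p) * 'd omega p v.
  have ds := smooth_differentiable (smooth_sin oD Som) Dp.
  by apply: (etrans (diff_opp v ds)); rewrite (diff_sin v Som Dp) mulNr.
have [al0 be0] := bracket_eq0 s0 (sin2cos2 _) (P11 Dp) (P33 Dp) (P13 Dp)
  (NP11 Dp) (NP33 Dp) (NP13 Dp) (NP31 Dp) (normal_derive1 Dp) (normal_derive3 Dp) bP bN
  (dot_diag (dot_rule_cst oD (E1 p) SP1 SP1 P11 Dp))
  (dot_diag (dot_rule_cst oD (E3 p) SP1 SP1 P11 Dp))
  (dot_diag (dot_rule_cst oD (E1 p) SP3 SP3 P33 Dp))
  (dot_diag (dot_rule_cst oD (E3 p) SP3 SP3 P33 Dp))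
  (etrans (dot_rule oD (E1 p) SP1 SP3 P13 Dp) (diff_cos (E1 p) Som Dp))
  (etrans (dot_rule oD (E3 p) SP1 SP3 P13 Dp) (diff_cos (E3 p) Som Dp))
  (etrans (dot_rule oD (E1 p) SN3 SP1 NP31 Dp) (diff_nsin (E1 p)))
  (etrans (dot_rule oD (E3 p) SN1 SP3 NP13 Dp) (diff_nsin (E3 p)))
  (dot_rule_cst oD (E1 p) SN3 SP3 NP33 Dp)
  (dot_rule_cst oD (E3 p) SN1 SP1 NP11 Dp).
by rewrite Z al0 be0 !scale0r addr0.
Qed.

Lemma diff_commute n (f : 'rV[R]_2 -> 'rV[R]_n) p : smooth D f -> D p ->
  'd (fun q => 'd f q (E3 q)) p (E1 p) = 'd (fun q => 'd f q (E1 q)) p (E3 p).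
Proof.
move=> Sf Dp; apply/eqP; rewrite -subr_eq0; apply/eqP.
apply: (etrans (diff_bracket oD Sf SE1 SE3 Dp)).
by rewrite (frame_commutes Dp) linear0.
Qed.

Lemma mixed_derivative p : D p -> 'd P3 p (E1 p) = 'd P1 p (E3 p).
Proof. by rewrite P1E P3E; exact: diff_commute. Qed.

(** E1 p3 = E3 p1 is a derivative of two unit fields at once, hence orthogonal to both. *)
Lemma mixed_derivative_dot p : D p ->
  dot ('d P3 p (E1 p)) (P1 p) = 0 /\ dot ('d P3 p (E1 p)) (P3 p) = 0.
Proof.
move=> Dp; split; last by apply: dot_diag; exact: dot_rule_cst P33 Dp.
apply: (etrans (congr1 (fun X => dot X (P1 p)) (mixed_derivative Dp))).
by apply: dot_diag; exact: dot_rule_cst P11 Dp.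
Qed.

Lemma asymptotic_derivative1 p : D p -> dot ('d P1 p (E1 p)) (P1 p) = 0 /\
  dot ('d P1 p (E1 p)) (P3 p) = - sin (omega p) * 'd omega p (E1 p).
Proof.
move=> Dp; split; first by apply: dot_diag; exact: dot_rule_cst P11 Dp.
have [c1 _] := mixed_derivative_dot Dp; apply: (eq_addr0 (etrans (dotC _ _) c1)).
exact: (etrans (dot_rule oD (E1 p) SP1 SP3 P13 Dp) (diff_cos (E1 p) Som Dp)).
Qed.

Lemma asymptotic_derivative3 p : D p -> dot ('d P3 p (E3 p)) (P3 p) = 0 /\
  dot ('d P3 p (E3 p)) (P1 p) = - sin (omega p) * 'd omega p (E3 p).
Proof.
move=> Dp; split; first by apply: dot_diag; exact: dot_rule_cst P33 Dp.
have [_ c3] := mixed_derivative_dot Dp.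
have {}c3 := etrans (congr1 (fun X => dot X (P3 p)) (esym (mixed_derivative Dp))) c3.
apply: (etrans (dotC _ _)); apply: (eq_add0r c3).
exact: (etrans (dot_rule oD (E3 p) SP1 SP3 P13 Dp) (diff_cos (E3 p) Som Dp)).
Qed.

Lemma sine_gordon p : D p -> hess omega E1 E3 p = sin (omega p).
Proof.
move=> Dp; have s0 : sin (omega p) != 0 by rewrite gt_eqF// sin_gt0.
pose W3 q : R := 'd omega q (E3 q).
have SW3 : smooth D W3 by exact: smooth_diff.
pose Q13 q := 'd P3 q (E1 q); pose Q33 q := 'd P3 q (E3 q).
have S13 : smooth D Q13 by exact: smooth_diff.
have S33 : smooth D Q33 by exact: smooth_diff.
have Ssin := smooth_sin oD Som.
have e : dot ('d Q33 p (E1 p)) (P1 p) + dot (Q33 p) ('d P1 p (E1 p)) =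
    - (cos (omega p) * 'd omega p (E1 p) * W3 p + sin (omega p) * 'd W3 p (E1 p)).
  apply: (etrans (dot_rule oD (E1 p) S33 SP1
    (fun q Dq => (asymptotic_derivative3 Dq).2) Dp)).
  have ds := smooth_differentiable (smoothN oD Ssin) Dp.
  have [_ H] := differentiable_scale ds (smooth_differentiable SW3 Dp).
  apply: (etrans (H (E1 p))); rewrite /GRing.scale/=.
  have nsin := etrans (diff_opp (E1 p) (smooth_differentiable Ssin Dp))
    (congr1 -%R (diff_sin (E1 p) Som Dp)).
  apply: (etrans (congr1 (fun x => x * W3 p + - sin (omega p) * 'd W3 p (E1 p)) nsin)).
  by rewrite /= !mulNr opprD.
(* The third derivative of [psi] is traded for E3 (E1 p3), whose product with [P1] follows by
   differentiating the orthogonality of E1 p3 and [P1] along [E3]. *)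
have comm : 'd Q33 p (E1 p) = 'd Q13 p (E3 p) := diff_commute SP3 Dp.
have dd : dot ('d Q33 p (E1 p)) (P1 p) + dot (Q13 p) (Q13 p) = 0.
  apply: etrans (dot_rule_cst oD (E3 p) S13 SP1
    (fun q Dq => (mixed_derivative_dot Dq).1) Dp).
  exact: (congr2 (fun X Y => dot X (P1 p) + dot (Q13 p) Y) comm (mixed_derivative Dp)).
have [a1 a3] := asymptotic_derivative1 Dp; have [b3 b1] := asymptotic_derivative3 Dp.
have [c1 c3] := mixed_derivative_dot Dp.
have nd13 : dot (N1 p) (P3 p) + dot (N p) (Q13 p) = 0.
  apply: etrans (dot_rule_cst oD (E1 p) SN SP3 NP3 Dp).
  by congr (dot _ _ + _); rewrite N1E.
have nd33 : dot (N p) (Q33 p) = 0.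
  apply: eq_add0r (dot_rule_cst oD (E3 p) SN SP3 NP3 Dp).
  have n3 : 'd N p (E3 p) = N3 p := esym (congr1 (@^~ p) N3E).
  exact: (etrans (congr1 (fun X => dot X (P3 p)) n3) (NP33 Dp)).
exact: (gauss_equation s0 (sin2cos2 _) (sin2_neq0 Dp) (P11 Dp) (P33 Dp) (NN Dp)
  (NP1 Dp) (NP3 Dp) (P13 Dp) (NP13 Dp) a1 a3 b3 b1 c1 c3 nd13 nd33 dd e).
Qed.

Lemma rotation_frame (eta xi : 'rV[R]_2 -> 'rV[R]_3) :
  smooth D eta -> smooth D xi ->
  (forall q, D q -> forall w, 'd xi q w = cross (eta q) ('d psi q w)) ->
  exists b c : 'rV[R]_2 -> R, [/\ smooth D b, smooth D c,
    forall q, D q -> 'd eta q (E1 q) = c q *: P3 q &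
    forall q, D q -> 'd eta q (E3 q) = b q *: P1 q].
Proof.
move=> Seta Sxi xiE.
pose H1 q := 'd eta q (E1 q); pose H3 q := 'd eta q (E3 q).
have SH1 : smooth D H1 by exact: smooth_diff.
have SH3 : smooth D H3 by exact: smooth_diff.
have Scos : smooth D (fun q => cos (omega q)) by move=> k; have [] := Ck_sin_cos oD (Som k).
have Sden : smooth D (fun q => (1 - cos (omega q) ^+ 2)^-1).
  move=> k; apply: CkV => // [q Dq|]; first exact: sin2_neq0.
  by apply: CkB => //; [exact: Ck_cst|exact: CkM].
have Scoef (h u v : 'rV[R]_2 -> 'rV[R]_3) : smooth D h -> smooth D u -> smooth D v ->
    smooth D (fun q => (dot (h q) (u q) - cos (omega q) * dot (h q) (v q)) /
                       (1 - cos (omega q) ^+ 2)).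
  move=> Sh Su Sv k; apply: CkM => //.
  by apply: CkB => //; [exact: Ck_dot|apply: CkM => //; exact: Ck_dot].
have hx q : D q -> cross (H3 q) (P1 q) = cross (H1 q) (P3 q).
  by move=> Dq; rewrite P1E P3E; exact: (rotation_compat oD _ _ Spsi Seta Sxi xiE Dq).
have tan q : D q -> dot (H1 q) (N q) = 0 /\ dot (H3 q) (N q) = 0.
  move=> Dq; exact: (rotation_tangent (P11 Dq) (P33 Dq) (NN Dq) (NP1 Dq) (NP3 Dq)
    (P13 Dq) (sin2_neq0 Dq) (hx q Dq)).
(* Tangency has to come first: [fundII_sym] applies to [eta] only once [N] is known to be normal to
   it. *)
have Neta q : D q -> forall w, dot (N q) ('d eta q w) = 0.
  move=> Dq w; have [al [be ->]] := span Dq w; have [t1 t3] := tan q Dq.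
  rewrite linearD !linearZ /= dotDr !dotZr.
  by rewrite !(dotC (N q)) t1 t3 !mulr0 addr0.
(* The witnesses are the coordinates from [frame_decomp]. In this form they are visibly smooth,
   which the pseudo-inverse in [coef_b] and [coef_c] hides. *)
exists (fun q => (dot (H3 q) (P1 q) - cos (omega q) * dot (H3 q) (P3 q)) /
  (1 - cos (omega q) ^+ 2)).
exists (fun q => (dot (H1 q) (P3 q) - cos (omega q) * dot (H1 q) (P1 q)) /
  (1 - cos (omega q) ^+ 2)).
have E q : D q -> _ /\ _ := fun Dq => rotation_coeffs (P11 Dq) (P33 Dq) (NN Dq)
  (NP1 Dq) (NP3 Dq) (P13 Dq) (sin2_neq0 Dq) (hx q Dq) (lt0r_neq0 (sin_gt0 Dq))
  (NP11 Dq) (NP33 Dq) (NP13 Dq) (NP31 Dq)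
  (etrans (congr1 (fun X => dot X (H3 q)) (congr1 (@^~ q) N1E))
    (etrans (fundII_sym oD (E1 q) (E3 q) Seta SN Neta Dq)
      (congr1 (fun X => dot X (H1 q)) (esym (congr1 (@^~ q) N3E))))).
split; [exact: Scoef|exact: Scoef| |] => q Dq; have [e1 e3] := E q Dq.
  exact: e1.
exact: e3.
Qed.

Lemma compatibility_equations (eta : 'rV[R]_2 -> 'rV[R]_3) (b c : 'rV[R]_2 -> R) p :
  smooth D eta -> smooth D b -> smooth D c ->
  (forall q, D q -> 'd eta q (E1 q) = c q *: P3 q) ->
  (forall q, D q -> 'd eta q (E3 q) = b q *: P1 q) -> D p ->
  - 'd b p (E1 p) = c p * csc (omega p) * 'd omega p (E3 p)
                    + b p * cot (omega p) * 'd omega p (E1 p) /\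
  - 'd c p (E3 p) = c p * cot (omega p) * 'd omega p (E3 p)
                    + b p * csc (omega p) * 'd omega p (E1 p).
Proof.
move=> Seta Sb Sc H1E H3E Dp.
have [a1 a3] := asymptotic_derivative1 Dp; have [b3 b1] := asymptotic_derivative3 Dp.
apply: (compatibility_coeffs (lt0r_neq0 (sin_gt0 Dp)) (sin2cos2 _) (P11 Dp) (P33 Dp)
  (P13 Dp) a1 a3 b3 b1).
have [_ db] := differentiable_scale (smooth_differentiable Sb Dp)
  (smooth_differentiable SP1 Dp).
have [_ dc] := differentiable_scale (smooth_differentiable Sc Dp)
  (smooth_differentiable SP3 Dp).
apply: (etrans (esym (db (E1 p)))); apply: (etrans _ (dc (E3 p))).
apply: (etrans (esym (diff_eq_on oD (E1 p) (smooth_diff oD Seta SE3) Dp H3E))).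
apply: (etrans (diff_commute Seta Dp)).
exact: (diff_eq_on oD (E3 p) (smooth_diff oD Seta SE1) Dp H1E).
Qed.

End K_surface_calculus.

(** * Dual bases *)

Section linear_forms.
Context {R : realType}.

Lemma linear_formE (th : {linear 'rV[R]_2 -> R}) u :
  th u = \sum_k u 0 k * th (delta_mx 0 k).
Proof.
rewrite {1}(row_sum_delta u) linear_sum.
by apply: eq_bigr => k _; rewrite linearZ.
Qed.

(** The four hypotheses say [M *m T = 1]; for square matrices this implies [T *m M = 1], which is
    the expansion of [u]. *)
Lemma dual_basis_decomp (t1 t3 : {linear 'rV[R]_2 -> R}) (u1 u3 u : 'rV[R]_2) :
  t1 u1 = 1 -> t1 u3 = 0 -> t3 u1 = 0 -> t3 u3 = 1 ->
  u = t1 u *: u1 + t3 u *: u3.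
Proof.
move=> t11 t13 t31 t33.
pose M : 'M[R]_2 := \matrix_(i, j) (if i == 0 then u1 else u3) 0 j.
pose T : 'M[R]_2 := \matrix_(i, j) (if j == 0 then t1 else t3) (delta_mx 0 i).
have MT : M *m T = 1%:M.
  apply/matrixP => i j; rewrite !mxE.
  transitivity ((if j == 0 then t1 else t3) (if i == 0 then u1 else u3)).
    by rewrite linear_formE; apply: eq_bigr => k _; rewrite !mxE.
  by case: i j => [[|[|//]] ?] [[|[|//]] ?].
have uTM : u = (u *m T) *m M by rewrite -mulmxA (mulmx1C MT) mulmx1.
have uT j : (u *m T) 0 j = (if j == 0 then t1 else t3) u.
  by rewrite mxE linear_formE; apply: eq_bigr => k _; rewrite !mxE.
apply/rowP => j; rewrite {1}uTM mxE !big_ord_recl big_ord0 addr0 !uT /= !mxE.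
by [].
Qed.

End linear_forms.

(** * The rotation operator, and asymptotic directions when K = -1 *)

Section surface.
Context {R : realType}.

(** Injectivity of the differential makes the Jacobian row-free, and then [pinvmx] is a right
    inverse of it. *)
Lemma rotation_op_eq (psi eta : 'rV[R]_2 -> 'rV[R]_3) p v k w :
  injective ('d psi p) -> 'd eta p v = k *: 'd psi p w ->
  rotation_op psi eta p v = k *: w.
Proof.
move=> inj E; pose J := lin1_mx ('d psi p).
have JE u : u *m J = 'd psi p u := mul_rV_lin1 ('d psi p) u.
have fJ : row_free J.
  apply: inj_row_free => u uJ; apply: inj.
  exact: (etrans (esym (JE u)) (etrans uJ (esym (linear0 _)))).
have H : 'd eta p v = (k *: w) *m J.
  by apply: (etrans E); rewrite -scalemxAl JE.
exact: (etrans (congr1 (fun X => X *m pinvmx J) H) (mulmxKp fJ _)).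
Qed.

(** In an asymptotic unit frame with II (u1, u3) = k the Gaussian curvature is - k^2 / s^2, so K =
    -1 gives k^2 = s^2, and positivity of both selects the root. *)
Lemma asymptotic_sine (psi N : 'rV[R]_2 -> 'rV[R]_3) p u1 u3 (s co k : R) :
  0 < s -> s ^+ 2 = 1 - co ^+ 2 -> 0 < k ->
  fundI psi p u1 u1 = 1 -> fundI psi p u3 u3 = 1 -> fundI psi p u1 u3 = co ->
  dot (N p) (N p) = 1 -> (forall v, dot (N p) ('d psi p v) = 0) ->
  (forall v, dot ('d N p v) (N p) = 0) ->
  dot ('d N p u1) ('d psi p u1) = 0 -> dot ('d N p u3) ('d psi p u3) = 0 ->
  dot ('d N p u1) ('d psi p u3) = - k -> dot ('d N p u3) ('d psi p u1) = - k ->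
  gauss_curvature psi N p = -1 -> k = s.
Proof.
move=> s0 s2 k0 f11 f33 f13 NN Npsi dNN n11 n33 n13 n31 gK.
have s20 : s ^+ 2 != 0 by rewrite expf_neq0// gt_eqF.
have co1 : 1 - co ^+ 2 != 0 by rewrite -s2.
have dec := frame_decomp f11 f33 NN (Npsi u1) (Npsi u3) f13 co1.
have n1E : 'd N p u1 = (co * k / s ^+ 2) *: 'd psi p u1 + (- k / s ^+ 2) *: 'd psi p u3.
  apply: (etrans (dec _)); move: n11 n13 (dNN u1).
  move: (dot _ _) (dot _ _) (dot _ _) => x y z -> -> ->.
  rewrite scale0r addr0 -s2.
  congr (_ / _ *: _ + _ / _ *: _); ring.
have n3E : 'd N p u3 = (- k / s ^+ 2) *: 'd psi p u1 + (co * k / s ^+ 2) *: 'd psi p u3.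
  apply: (etrans (dec _)); move: n33 n31 (dNN u3).
  move: (dot _ _) (dot _ _) (dot _ _) => x y z -> -> ->.
  rewrite scale0r addr0 -s2.
  congr (_ / _ *: _ + _ / _ *: _); ring.
have G0 : fundI psi p u1 u1 * fundI psi p u3 u3 - fundI psi p u1 u3 ^+ 2 != 0.
  by rewrite f11 f33 f13 mulr1.
have [gE _] := shape_frame G0 n1E n3E.
have : k ^+ 2 = s ^+ 2.
  move: gE; rewrite gK => gE; apply: (mulIf s20).
  have -> : k ^+ 2 * s ^+ 2 = - (co * k / s ^+ 2 * (co * k / s ^+ 2)
     - - k / s ^+ 2 * (- k / s ^+ 2)) * s ^+ 2 * s ^+ 2.
    transitivity (k ^+ 2 * (1 - co ^+ 2)); first by rewrite -s2.
    by field; rewrite gt_eqF.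
  by rewrite -gE; ring.
by move/eqP; rewrite eqrXn2 ?ltW// => /eqP.
Qed.

End surface.

Lemma linear_comb (R : realType) (V W : lmodType R) (L : {linear V -> W}) a b u v :
  L (a *: u + b *: v) = a *: L u + b *: L v.
Proof. by rewrite linearD !linearZ. Qed.

(** * Fundamental forms of a V-surface *)

Section V_forms.
Context {R : realType}.
Variables (N eta : 'rV[R]_2 -> 'rV[R]_3) (p u1 u3 : 'rV[R]_2).
Variables (t1 t3 : {linear 'rV[R]_2 -> R}) (p1 p3 n1 n3 : 'rV[R]_3) (om b c : R).
Hypotheses (t11 : t1 u1 = 1) (t13 : t1 u3 = 0) (t31 : t3 u1 = 0) (t33 : t3 u3 = 1).
Hypotheses (h1 : 'd eta p u1 = c *: p3) (h3 : 'd eta p u3 = b *: p1).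
Hypotheses (dn1 : 'd N p u1 = n1) (dn3 : 'd N p u3 = n3).
Hypotheses (p11 : dot p1 p1 = 1) (p33 : dot p3 p3 = 1) (p13 : dot p1 p3 = cos om).
Hypotheses (np11 : dot n1 p1 = 0) (np33 : dot n3 p3 = 0).
Hypotheses (np13 : dot n1 p3 = - sin om) (np31 : dot n3 p1 = - sin om).
Hypotheses (n1E : n1 = cot om *: p1 - csc om *: p3).
Hypotheses (n3E : n3 = cot om *: p3 - csc om *: p1).
Hypotheses (s0 : sin om != 0) (b0 : b != 0) (c0 : c != 0).

Lemma diff_eta u : 'd eta p u = t1 u *: (c *: p3) + t3 u *: (b *: p1).
Proof.
have E := dual_basis_decomp u t11 t13 t31 t33.
apply: (etrans (congr1 ('d eta p) E)).
apply: (etrans (linear_comb _ _ _ _ _)).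
exact: (congr2 (fun X Y => t1 u *: X + t3 u *: Y) h1 h3).
Qed.

Lemma diff_normal u : 'd N p u = t1 u *: n1 + t3 u *: n3.
Proof.
have E := dual_basis_decomp u t11 t13 t31 t33.
apply: (etrans (congr1 ('d N p) E)).
apply: (etrans (linear_comb _ _ _ _ _)).
exact: (congr2 (fun X Y => t1 u *: X + t3 u *: Y) dn1 dn3).
Qed.

Lemma fundI_eta u v : fundI eta p u v =
  c ^+ 2 * tensor t1 t1 u v + 2 * b * c * cos om * sym_tensor t1 t3 u v
  + b ^+ 2 * tensor t3 t3 u v.
Proof.
apply: (etrans (congr2 (fun X Y => dot X Y) (diff_eta u) (diff_eta v))).
rewrite /= !dotDl !dotDr !dotZl !dotZr p11 p33 (dotC p3) p13 /sym_tensor /tensor.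
by field.
Qed.

Lemma fundII_eta u v : fundII eta N p u v =
  sin om * (c * tensor t1 t1 u v + b * tensor t3 t3 u v).
Proof.
apply: (etrans (congr2 (fun X Y => - dot X Y) (diff_normal u) (diff_eta v))).
rewrite /= !dotDl !dotDr !dotZl !dotZr np11 np33 np13 np31 /tensor.
by ring.
Qed.

(** Replacing [p1], [p3] by multiples of the derivatives of [eta] along [u3], [u1] puts csc on the
    diagonal of the Weingarten matrix; the Gaussian curvature is then (csc^2 - cot^2) / (b c). *)
Lemma curvatures_eta :
  mean_curvature eta N p = (b + c) / (2 * b * c * sin om) /\
  gauss_curvature eta N p = (b * c)^-1.
Proof.
have n1h : 'd N p u1 = (- csc om / c) *: 'd eta p u1 + (cot om / b) *: 'd eta p u3.
  apply: (etrans dn1); apply: (etrans n1E); rewrite h1 h3 !scalerA !divfK//.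
  by rewrite scaleNr addrC.
have n3h : 'd N p u3 = (cot om / c) *: 'd eta p u1 + (- csc om / b) *: 'd eta p u3.
  apply: (etrans dn3); apply: (etrans n3E); rewrite h1 h3 !scalerA !divfK//.
  by rewrite scaleNr.
have G0 : fundI eta p u1 u1 * fundI eta p u3 u3 - fundI eta p u1 u3 ^+ 2 != 0.
  rewrite !fundI_eta /sym_tensor /tensor t11 t13 t31 t33.
  rewrite (_ : _ - _ = (b * c * sin om) ^+ 2); first by rewrite expf_neq0// !mulf_neq0.
  by rewrite [RHS]exprMn sin2cos2; field.
have [gE mE] := shape_frame G0 n1h n3h.
have cs := sin2cos2 om.
split.
  by apply: (etrans mE); rewrite /csc; field; rewrite s0 b0 c0.
apply: (etrans gE); rewrite /csc /cot.
transitivity ((1 - cos om ^+ 2) / (b * c * sin om ^+ 2)).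
  by field; rewrite s0 b0 c0.
by rewrite -cs; field; rewrite s0 b0 c0.
Qed.

End V_forms.

Theorem theorem3p15 (R : realType) (D : set 'rV[R]_2)
    (psi N eta : 'rV[R]_2 -> 'rV[R]_3)
    (E1 E3 : 'rV[R]_2 -> 'rV[R]_2)
    (th1 th3 : 'rV[R]_2 -> {linear 'rV[R]_2 -> R})
    (omega : 'rV[R]_2 -> R) :
  K_surface D psi N ->
  V_surface D psi N eta ->
  K_frame D psi N E1 E3 ->
  dual_coframe D E1 E3 th1 th3 ->
  frame_angle D psi E1 E3 omega ->
  let b := coef_b psi eta E3 th1 in
  let c := coef_c psi eta E1 th3 in
  let F1 := vframe c E1 in
  let F3 := vframe b E3 in
  let F2 := vframe2 omega F1 F3 in
  let F4 := vframe4 omega F1 F3 in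
  [/\ smooth D b, smooth D c & smooth D omega] /\
  forall p, D p ->
  [/\ (* fundamental forms *)
      forall u v,
        fundI eta p u v =
          c p ^+ 2 * tensor (th1 p) (th1 p) u v
          + 2 * b p * c p * cos (omega p) * sym_tensor (th1 p) (th3 p) u v
          + b p ^+ 2 * tensor (th3 p) (th3 p) u v
        /\
        fundII eta N p u v =
          sin (omega p) * (c p * tensor (th1 p) (th1 p) u v
                           + b p * tensor (th3 p) (th3 p) u v),
      (* compatibility equations *)
      [/\ - 'd b p (E1 p) = c p * csc (omega p) * 'd omega p (E3 p)
                            + b p * cot (omega p) * 'd omega p (E1 p),
          - 'd c p (E3 p) = c p * cot (omega p) * 'd omega p (E3 p)
                            + b p * csc (omega p) * 'd omega p (E1 p) &
          hess omega E1 E3 p = sin (omega p)],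
      (* curvatures and torsions of the V-net lines *)
      [/\ net_curvature eta N F1 p = (c p)^-1 * sin (omega p),
          net_torsion eta N F1 F2 p = - (c p)^-1 * cos (omega p),
          net_curvature eta N F3 p = (b p)^-1 * sin (omega p) &
          net_torsion eta N F3 F4 p = (b p)^-1 * cos (omega p)] &
      (* mean and Gaussian curvatures *)
      mean_curvature eta N p = (b p + c p) / (2 * b p * c p * sin (omega p))
      /\ gauss_curvature eta N p = (b p * c p)^-1].
Proof.
move=> [[oD _ [Spsi inj_psi]] [SN Nnorm] gK] [[Seta [xi [Sxi xiE]]] [_ inj_eta] _].
move=> [SE1 SE3 frame] coframe angle b c F1 F3 F2 F4.
pose P1 q := 'd psi q (E1 q); pose P3 q := 'd psi q (E3 q).
pose N1 q := 'd N q (E1 q); pose N3 q := 'd N q (E3 q).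
have SP1 : smooth D P1 by exact: smooth_diff.
have SP3 : smooth D P3 by exact: smooth_diff.
have Som : smooth D omega.
  apply: smooth_angle => // [q Dq|k]; first by have [] := angle q Dq.
  apply: (Ck_ext oD _ (Ck_dot oD (SP1 k) (SP3 k))) => q Dq.
  by have [_ ->] := angle q Dq.
have sin0 q : D q -> 0 < sin (omega q).
  by move=> Dq; have [om _] := angle q Dq; exact: sin_gt0_pi.
have NN q : D q -> dot (N q) (N q) = 1 by move=> Dq; have [] := Nnorm q Dq.
have Npsi q : D q -> forall v, dot (N q) ('d psi q v) = 0.
  by move=> Dq; have [] := Nnorm q Dq.
have P11 q : D q -> dot (P1 q) (P1 q) = 1 by move=> Dq; have [] := frame q Dq.
have P33 q : D q -> dot (P3 q) (P3 q) = 1 by move=> Dq; have [] := frame q Dq.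
have P13 q : D q -> dot (P1 q) (P3 q) = cos (omega q).
  by move=> Dq; have [_ ->] := angle q Dq.
have NP11 q : D q -> dot (N1 q) (P1 q) = 0.
  by move=> Dq; have [_ _ /eqP] := frame q Dq; rewrite oppr_eq0 => /eqP.
have NP33 q : D q -> dot (N3 q) (P3 q) = 0.
  by move=> Dq; have [_ _ _ /eqP] := frame q Dq; rewrite oppr_eq0 => /eqP.
have NP31' q : D q -> dot (N3 q) (P1 q) = dot (N1 q) (P3 q).
  by move=> Dq; exact: (fundII_sym oD _ _ Spsi SN Npsi Dq).
have NP13 q : D q -> dot (N1 q) (P3 q) = - sin (omega q).
  move=> Dq; have [_ _ _ _ k0] := frame q Dq.
  have dNN v : dot ('d N q v) (N q) = 0.
    exact: unit_normal_derive NN Dq.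
  have n13 : dot (N1 q) (P3 q) = - fundII psi N q (E1 q) (E3 q) by rewrite opprK.
  have E := asymptotic_sine (sin0 q Dq) (sin2cos2 _) k0 (P11 q Dq) (P33 q Dq) (P13 q Dq)
    (NN q Dq) (Npsi q Dq) dNN (NP11 q Dq) (NP33 q Dq) n13
    (etrans (NP31' q Dq) n13) (gK q Dq).
  exact: (etrans n13 (congr1 -%R E)).
have NP31 q : D q -> dot (N3 q) (P1 q) = - sin (omega q).
  by move=> Dq; exact: (etrans (NP31' q Dq) (NP13 q Dq)).
have span q : D q -> forall u, exists al be, u = al *: E1 q + be *: E3 q.
  move=> Dq u; have [t11 t13 t31 t33] := coframe q Dq.
  by exists (th1 q u), (th3 q u); exact: dual_basis_decomp.
have NP1 q (Dq : D q) := Npsi q Dq (E1 q); have NP3 q (Dq : D q) := Npsi q Dq (E3 q).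
have [b' [c' [Sb' Sc' H1 H3]]] := rotation_frame oD Spsi SN SE1 SE3 Som erefl erefl
  erefl erefl sin0 span NN NP1 NP3 P11 P33 P13 NP11 NP33 NP13 NP31 Seta Sxi xiE.
have bE q : D q -> b' q = b q.
  move=> Dq; have [t11 _ _ _] := coframe q Dq.
  rewrite /b /coef_b (rotation_op_eq (inj_psi q Dq) (H3 q Dq)).
  exact: (esym (etrans (linearZ _ _) (etrans (congr1 ( *%R (b' q)) t11) (mulr1 _)))).
have cE q : D q -> c' q = c q.
  move=> Dq; have [_ _ _ t33] := coframe q Dq.
  rewrite /c /coef_c (rotation_op_eq (inj_psi q Dq) (H1 q Dq)).
  exact: (esym (etrans (linearZ _ _) (etrans (congr1 ( *%R (c' q)) t33) (mulr1 _)))).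
have Sb : smooth D b by move=> k; exact: (Ck_ext oD bE (Sb' k)).
have Sc : smooth D c by move=> k; exact: (Ck_ext oD cE (Sc' k)).
have {}H1 q : D q -> 'd eta q (E1 q) = c q *: P3 q by move=> Dq; rewrite -cE//; exact: H1.
have {}H3 q : D q -> 'd eta q (E3 q) = b q *: P1 q by move=> Dq; rewrite -bE//; exact: H3.
split=> // p Dp.
have [t11 t13 t31 t33] := coframe p Dp.
have s0 : sin (omega p) != 0 := lt0r_neq0 (sin0 p Dp).
have b0 : b p != 0.
  apply/eqP => bp0; have : E3 p = 0.
    apply: (inj_eta p Dp); apply: (etrans (H3 p Dp)).
    by rewrite bp0 scale0r linear0.
  by move=> E30; move: t33; rewrite E30 linear0 => /eqP; rewrite eq_sym oner_eq0.
have c0 : c p != 0.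
  apply/eqP => cp0; have : E1 p = 0.
    apply: (inj_eta p Dp); apply: (etrans (H1 p Dp)).
    by rewrite cp0 scale0r linear0.
  by move=> E10; move: t11; rewrite E10 linear0 => /eqP; rewrite eq_sym oner_eq0.
have n1E := normal_derive1 oD SN erefl sin0 NN NP1 NP3 P11 P33 P13 NP11 NP13 Dp.
have n3E := normal_derive3 oD SN erefl sin0 NN NP1 NP3 P11 P33 P13 NP33 NP31 Dp.
have I := fundI_eta t11 t13 t31 t33 (H1 p Dp) (H3 p Dp) (P11 p Dp) (P33 p Dp) (P13 p Dp).
have II := fundII_eta t11 t13 t31 t33 (H1 p Dp) (H3 p Dp) erefl erefl
  (NP11 p Dp) (NP33 p Dp) (NP13 p Dp) (NP31 p Dp).
split.
- by move=> u v; split; [exact: I|exact: II].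
- have [eb ec] := compatibility_equations oD Spsi SN SE1 SE3 Som erefl erefl erefl erefl
    sin0 span NN NP1 NP3 P11 P33 P13 NP11 NP33 NP13 NP31 Seta Sb Sc H1 H3 Dp.
  split; [exact: eb|exact: ec|].
  exact: (sine_gordon oD Spsi SN SE1 SE3 Som erefl erefl erefl erefl
    sin0 span NN NP1 NP3 P11 P33 P13 NP11 NP33 NP13 NP31 Dp).
- have t1F1 : th1 p (F1 p) = (c p)^-1.
    exact: (etrans (linearZ _ _) (etrans (congr1 ( *%R _) t11) (mulr1 _))).
  have t3F1 : th3 p (F1 p) = 0.
    exact: (etrans (linearZ _ _) (etrans (congr1 ( *%R _) t31) (mulr0 _))).
  have t1F3 : th1 p (F3 p) = 0.
    exact: (etrans (linearZ _ _) (etrans (congr1 ( *%R _) t13) (mulr0 _))).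
  have t3F3 : th3 p (F3 p) = (b p)^-1.
    exact: (etrans (linearZ _ _) (etrans (congr1 ( *%R _) t33) (mulr1 _))).
  have comb (th : {linear 'rV[R]_2 -> R}) x y u v :
      th (x *: u - y *: v) = x * th u - y * th v.
    by rewrite -scaleNr -mulNr; exact: linear_comb.
  (* [II] is diagonal in the coframe, so each torsion is the normal curvature of its line times the
     component of the rotated vector along that line, - cot for [F2] and cot for [F4]. *)
  rewrite /net_curvature /net_torsion !II /tensor !comb t1F1 t3F1 t1F3 t3F3 /csc /cot.
  by split; field; rewrite ?s0 ?b0 ?c0.
- exact: (curvatures_eta t11 t13 t31 t33 (H1 p Dp) (H3 p Dp) erefl erefl
    (P11 p Dp) (P33 p Dp) (P13 p Dp) n1E n3E s0 b0 c0).
Qed.
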